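(* Let $X=\Gamma\backslash\mathbb{H}^2$ be a compact hyperbolic surface and let $\varrho:\Gamma\to\mathrm{GL}(V)$ be a linear representation of Teichmüller type, with associated Teichmüller representation $\rho$ and exponent $\beta>0$. Let $\delta=\delta(\varrho)$, let $\delta_0:=\eta/2$, where $\eta$ is the real number such that $(-2\beta,\eta)$ lies on the Manhattan curve $\mathfrak{C}$ of $\rho$, and set $$I_-(\rho):=\inf_{\gamma\in\mathcal{P}}\frac{\ell_\rho(\gamma)}{\ell(\gamma)},\qquad I_+(\rho):=\sup_{\gamma\in\mathcal{P}}\frac{\ell_\rho(\gamma)}{\ell(\gamma)}.$$ Then $$\frac{\delta}{2}+\frac{\beta}{2}I_-(\rho)\le\delta_0\le\frac{\delta}{2}+\frac{\beta}{2}I_+(\rho).$$ In particular, if $I_-(\rho)=I_+(\rho)=1$ then $\delta_0=\frac{\delta+\beta}{2}=\frac12+\beta$.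
   Context: $\mathbb{H}^2$ is the hyperbolic plane (upper half-plane model) with distance $d$, $\Gamma\subset\mathrm{PSL}_2(\mathbb{R})$ is discrete, co-compact and torsion-free, $V$ is a finite-dimensional complex vector space. $\mathcal{P}$ is the set of primitive conjugacy classes in $\Gamma$; $\ell(\gamma)$ is the translation length of $\gamma$. The critical exponent is $$\delta(\varrho):=\inf\Big\{s>0: \sum_{\gamma\in\mathcal{P},\,k\ge1}|\mathrm{tr}(\varrho(\gamma^k))|e^{-sk\ell(\gamma)}<\infty\Big\}.$$ A Teichmüller representation is a faithful discrete representation $\rho:\Gamma\to\mathrm{PSL}_2(\mathbb{R})$; $\ell_\rho(\gamma):=\ell(\rho(\gamma))$. The representation $\varrho$ is of Teichmüller type, with associated $\rho$ and exponent $\beta>0$, if there exist a norm $\|\cdot\|_0$ on $\mathrm{GL}(V)$ (restriction of a norm on $\mathrm{End}(V)$) and $C>0$ such that for all $\gamma\in\Gamma$: (1) $\|\varrho(\gamma)\|_0\le Ce^{\beta d(i,\rho(\gamma)i)}$; (2) $C^{-1}e^{\beta\ell(\rho(\gamma))}\le|\mathrm{tr}(\varrho(\gamma))|\le Ce^{\beta\ell(\rho(\gamma))}$. Manhattan curve: $\mathcal{M}_\rho:=\{(a,b)\in\mathbb{R}^2: \sum_{\gamma\in\mathcal{P},k\ge1}e^{-ak\ell_\rho(\gamma)-bk\ell(\gamma)}<\infty\}$ is convex; $\mathfrak{C}$ is its boundary, a convex graph containing $(0,1)$ and $(1,0)$. (The number $\delta$ satisfies $(-\beta,\delta)\in\mathfrak{C}$.)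 *)

(* Defs.v *)
From HB Require Import structures.
From mathcomp Require Import all_boot all_order all_algebra.
From mathcomp Require Import all_classical all_reals all_analysis.
From mathcomp Require Import complex ring lra.

Set Implicit Arguments.
Unset Strict Implicit.
Unset Printing Implicit Defensive.

Import Order.TTheory GRing.Theory Num.Theory numFieldNormedType.Exports.

Local Open Scope classical_set_scope.
Local Open Scope quotient_scope.
Local Open Scope complex_scope.
Local Open Scope ring_scope.

Section SL2.
Variable R : realType.

Record SL2 := MkSL2 { SL2_mx :> 'M[R]_2 ; _ : \det SL2_mx == 1 }.

HB.instance Definition _ := [isSub for SL2_mx].
HB.instance Definition _ := [Choice of SL2 by <:].
HB.instance Definition _ :=
  Topological.copy SL2 (initial_topology SL2_mx).

Lemma SL2_det (A : SL2) : \det A = 1.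
Proof. exact/eqP/(valP A). Qed.

Fact SL2_one_subproof : \det (1%:M : 'M[R]_2) == 1.
Proof. by rewrite det1. Qed.
Fact SL2_mul_subproof (A B : SL2) : \det (A *m B) == 1.
Proof. by rewrite det_mulmx !SL2_det mulr1. Qed.
Fact SL2_inv_subproof (A : SL2) : \det (invmx A) == 1.
Proof. by rewrite det_inv SL2_det invr1. Qed.

Definition SL2_one : SL2 := MkSL2 SL2_one_subproof.
Definition SL2_mul (A B : SL2) : SL2 := MkSL2 (SL2_mul_subproof A B).
Definition SL2_inv (A : SL2) : SL2 := MkSL2 (SL2_inv_subproof A).

Lemma SL2_unit (A : SL2) : (A : 'M[R]_2) \in unitmx.
Proof. by rewrite unitmxE SL2_det unitr1. Qed.

Fact SL2_mulA : associative SL2_mul.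
Proof. by move=> A B C; apply: val_inj => /=; rewrite mulmxA. Qed.
Fact SL2_mul1 : left_id SL2_one SL2_mul.
Proof. by move=> A; apply: val_inj => /=; rewrite mul1mx. Qed.
Fact SL2_1mul : right_id SL2_one SL2_mul.
Proof. by move=> A; apply: val_inj => /=; rewrite mulmx1. Qed.
Fact SL2_mulV : left_inverse SL2_one SL2_inv SL2_mul.
Proof. by move=> A; apply: val_inj => /=; rewrite mulVmx ?SL2_unit. Qed.
Fact SL2_Vmul : right_inverse SL2_one SL2_inv SL2_mul.
Proof. by move=> A; apply: val_inj => /=; rewrite mulmxV ?SL2_unit. Qed.

HB.instance Definition _ :=
  isGroup.Build SL2 SL2_mulA SL2_mul1 SL2_1mul SL2_mulV SL2_Vmul.

Definition eq_up_to_sign (A B : SL2) : bool :=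
  (SL2_mx A == SL2_mx B) || (SL2_mx A == - SL2_mx B).

Fact eq_up_to_sign_refl : reflexive eq_up_to_sign.
Proof. by move=> A; rewrite /eq_up_to_sign eqxx. Qed.
Fact eq_up_to_sign_sym : symmetric eq_up_to_sign.
Proof.
by move=> A B; rewrite /eq_up_to_sign eq_sym [X in _ || X]eq_sym eqr_oppLR.
Qed.
Fact eq_up_to_sign_trans : transitive eq_up_to_sign.
Proof.
move=> B A C; rewrite /eq_up_to_sign => /orP[]/eqP -> /orP[]/eqP ->;
  by rewrite ?opprK eqxx ?orbT.
Qed.
Canonical eq_up_to_sign_equiv :=
  EquivRel eq_up_to_sign eq_up_to_sign_refl eq_up_to_sign_sym
    eq_up_to_sign_trans.

Definition PSL2 := quotient_topology {eq_quot eq_up_to_sign}.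

HB.instance Definition _ := Quotient.on PSL2.
HB.instance Definition _ := Topological.on PSL2.

Lemma PSL2_eqP (A B : SL2) :
  reflect (\pi_PSL2 A = \pi_PSL2 B) (eq_up_to_sign A B).
Proof. exact: eqmodP. Qed.

Lemma PSL2_repr_pi (A : SL2) : eq_up_to_sign (repr (\pi_PSL2 A)) A.
Proof. by apply/PSL2_eqP; rewrite reprK. Qed.

Lemma PSL2P (g : PSL2) : exists A, g = \pi_PSL2 A.
Proof. by exists (repr g); rewrite reprK. Qed.

Definition PSL2_one : PSL2 := \pi_PSL2 SL2_one.
Definition PSL2_mul (g h : PSL2) : PSL2 := \pi_PSL2 (SL2_mul (repr g) (repr h)).
Definition PSL2_inv (g : PSL2) : PSL2 := \pi_PSL2 (SL2_inv (repr g)).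

Lemma SL2_mul_sign (A A' B B' : SL2) : eq_up_to_sign A A' ->
  eq_up_to_sign B B' -> eq_up_to_sign (SL2_mul A B) (SL2_mul A' B').
Proof.
rewrite /eq_up_to_sign /= => /orP[]/eqP -> /orP[]/eqP ->;
  by rewrite ?mulNmx ?mulmxN ?opprK eqxx ?orbT.
Qed.

Lemma PSL2_mulE (A B : SL2) :
  PSL2_mul (\pi_PSL2 A) (\pi_PSL2 B) = \pi_PSL2 (SL2_mul A B).
Proof.
by rewrite /PSL2_mul; apply/PSL2_eqP; apply: SL2_mul_sign; exact: PSL2_repr_pi.
Qed.

Fact PSL2_mulA : associative PSL2_mul.
Proof.
move=> f g h; case: (PSL2P f) (PSL2P g) (PSL2P h) => A -> [B ->] [C ->].
by rewrite !PSL2_mulE SL2_mulA.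
Qed.
Fact PSL2_mul1 : left_id PSL2_one PSL2_mul.
Proof. by move=> g; case: (PSL2P g) => A ->; rewrite PSL2_mulE SL2_mul1. Qed.
Fact PSL2_1mul : right_id PSL2_one PSL2_mul.
Proof. by move=> g; case: (PSL2P g) => A ->; rewrite PSL2_mulE SL2_1mul. Qed.
Fact PSL2_mulV : left_inverse PSL2_one PSL2_inv PSL2_mul.
Proof.
by move=> g; rewrite -{2}[g](@reprK _ PSL2) PSL2_mulE SL2_mulV.
Qed.
Fact PSL2_Vmul : right_inverse PSL2_one PSL2_inv PSL2_mul.
Proof.
by move=> g; rewrite -{1}[g](@reprK _ PSL2) PSL2_mulE SL2_Vmul.
Qed.

HB.instance Definition _ :=
  isGroup.Build PSL2 PSL2_mulA PSL2_mul1 PSL2_1mul PSL2_mulV PSL2_Vmul.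

End SL2.

Section HyperbolicPlane.
Variable R : realType.

Record H2 := MkH2 { H2_val :> R[i] ; _ : 0 < complex.Im H2_val }.

HB.instance Definition _ := [isSub for H2_val].
HB.instance Definition _ := [Choice of H2 by <:].
HB.instance Definition _ := Topological.copy H2
  (initial_topology (fun z : H2 => (complex.Re z, complex.Im z))).

Fact i_subproof : 0 < complex.Im ('i : R[i]).
Proof. exact: ltr01. Qed.
Definition H2_i : H2 := MkH2 i_subproof.

Definition arcosh (x : R) : R := ln (x + Num.sqrt (x ^+ 2 - 1)).

(* cosh d(z, w) = 1 + |z - w|^2 / (2 Im z Im w) *)
Definition hdist (z w : H2) : R :=
  arcosh (1 + (Normc.normc (H2_val z - H2_val w)) ^+ 2
              / (2 * complex.Im z * complex.Im w)).

Definition mobius_num (A : 'M[R]_2) (z : R[i]) : R[i] :=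
  (A 0 0)%:C * z + (A 0 1)%:C.
Definition mobius_den (A : 'M[R]_2) (z : R[i]) : R[i] :=
  (A 1 0)%:C * z + (A 1 1)%:C.

Lemma mobius_det (A : SL2 R) : A 0 0 * A 1 1 - A 0 1 * A 1 0 = 1.
Proof.
rewrite -(SL2_det A) (expand_det_row _ 0) !big_ord_recl big_ord0.
rewrite /cofactor !det_mx11 !mxE /=.
have -> : lift 0 0 = 1 :> 'I_2 by exact/val_inj.
have -> : lift 1 0 = 0 :> 'I_2 by exact/val_inj.
by rewrite /= expr0 expr1; ring.
Qed.

Lemma real_lin_complex (a b x y : R) :
  a%:C * (x +i* y) + b%:C = (a * x + b) +i* (a * y).
Proof.
by apply/eqP; rewrite eq_complex /=; apply/andP; split; apply/eqP; ring.
Qed.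

Lemma mobius_den_neq0 (A : SL2 R) (z : H2) : mobius_den A z != 0.
Proof.
have := mobius_det A; case: z => -[x y] /= y_gt0; rewrite /mobius_den.
move: (A 0 0) (A 0 1) (A 1 0) (A 1 1) => a b c d.
rewrite real_lin_complex => det1; apply/eqP => -[re0 im0].
have c0 : c = 0 by move/eqP: im0; rewrite mulf_eq0 (gt_eqF y_gt0) orbF => /eqP.
by move: re0 det1; rewrite c0 mul0r add0r => ->; lra.
Qed.

Fact mobius_subproof (A : SL2 R) (z : H2) :
  0 < complex.Im (mobius_num A z / mobius_den A z).
Proof.
have := mobius_den_neq0 A z; have := mobius_det A.
case: z => -[x y] /= y_gt0; rewrite /mobius_num /mobius_den.
move: (A 0 0) (A 0 1) (A 1 0) (A 1 1) => a b c d det1.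
rewrite !real_lin_complex eq_complex /= => den0.
have q_gt0 : 0 < (c * x + d) ^+ 2 + (c * y) ^+ 2.
  rewrite lt_neqAle addr_ge0 ?sqr_ge0 // andbT eq_sym.
  by rewrite paddr_eq0 ?sqr_ge0 // !sqrf_eq0.
rewrite !mul0r !subr0 !addr0.
suff -> : (a * x + b) * - (c * y / ((c * x + d) ^+ 2 + (c * y) ^+ 2)) +
    a * y * ((c * x + d) / ((c * x + d) ^+ 2 + (c * y) ^+ 2)) =
    y * (a * d - b * c) / ((c * x + d) ^+ 2 + (c * y) ^+ 2).
  by rewrite det1 mulr1 divr_gt0.
by ring.
Qed.

Definition mobius (A : SL2 R) (z : H2) : H2 := MkH2 (mobius_subproof A z).

(* [repr] picks one of the two lifts of g to SL2; see [act_pi]. *)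
Definition act (g : PSL2 R) (z : H2) : H2 := mobius (repr g) z.

Lemma mobius_sign (A B : SL2 R) (z : H2) :
  eq_up_to_sign A B -> mobius A z = mobius B z.
Proof.
move=> /orP[]/eqP AB; apply: val_inj; rewrite /= /mobius_num /mobius_den AB //.
by rewrite !mxE !rmorphN !mulNr -!opprD invrN mulrNN.
Qed.

Lemma act_pi (A : SL2 R) (z : H2) : act (\pi_(PSL2 R) A) z = mobius A z.
Proof. exact/mobius_sign/PSL2_repr_pi. Qed.

Lemma act1 (z : H2) : act 1%g z = z.
Proof.
rewrite -[1%g]/(\pi_(PSL2 R) (SL2_one R)) act_pi; apply: val_inj.
rewrite /= /mobius_num /mobius_den !mxE /=.
by rewrite rmorph0 rmorph1 mul0r mul1r add0r addr0 divr1.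
Qed.

Lemma mobius_numM (A B : SL2 R) (z : R[i]) : mobius_num (SL2_mul A B) z =
  (A 0 0)%:C * mobius_num B z + (A 0 1)%:C * mobius_den B z.
Proof.
rewrite /mobius_num /mobius_den /= !mxE !big_ord_recl !big_ord0.
have -> : lift ord0 ord0 = 1 :> 'I_2 by exact/val_inj.
by rewrite !addr0 !(rmorphD, rmorphM) /=; ring.
Qed.

Lemma mobius_denM (A B : SL2 R) (z : R[i]) : mobius_den (SL2_mul A B) z =
  (A 1 0)%:C * mobius_num B z + (A 1 1)%:C * mobius_den B z.
Proof.
rewrite /mobius_num /mobius_den /= !mxE !big_ord_recl !big_ord0.
have -> : lift ord0 ord0 = 1 :> 'I_2 by exact/val_inj.
by rewrite !addr0 !(rmorphD, rmorphM) /=; ring.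
Qed.

Lemma mobiusM (A B : SL2 R) (z : H2) :
  mobius (SL2_mul A B) z = mobius A (mobius B z).
Proof.
apply: val_inj => /=; rewrite mobius_numM mobius_denM.
have dB0 := mobius_den_neq0 B z.
have distr (a b : R) : a%:C * mobius_num B z + b%:C * mobius_den B z =
    (a%:C * (mobius_num B z / mobius_den B z) + b%:C) * mobius_den B z.
  by rewrite mulrDl -mulrA divfK.
by rewrite !distr -mulf_div divff // mulr1.
Qed.

Lemma actM (g h : PSL2 R) (z : H2) : act (g * h)%g z = act g (act h z).
Proof.
case: (PSL2P g) (PSL2P h) => A -> [B ->].
by rewrite [(_ * _)%g]PSL2_mulE !act_pi mobiusM.
Qed.

Definition translation_length (g : PSL2 R) : R :=
  inf [set hdist z (act g z) | z in [set: H2]].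

End HyperbolicPlane.

Section FuchsianGroup.
Variables (R : realType) (Gamma : groupClosed (PSL2 R)).

Definition orbit_rel (z w : H2 R) : bool :=
  `[< exists2 g, g \in Gamma & w = act g z >].

Fact orbit_rel_refl : reflexive orbit_rel.
Proof. by move=> z; apply/asboolP; exists 1%g; rewrite ?gpred1 ?act1. Qed.
Fact orbit_rel_sym : symmetric orbit_rel.
Proof.
suff H z w : orbit_rel z w -> orbit_rel w z.
  by move=> z w; apply/idP/idP; exact: H.
move=> /asboolP[g gG ->]; apply/asboolP; exists g^-1%g; first by rewrite gpredV.
by rewrite -actM mulVg act1.
Qed.
Fact orbit_rel_trans : transitive orbit_rel.
Proof.
move=> w z v /asboolP[g gG ->] /asboolP[h hG ->]; apply/asboolP.
by exists (h * g)%g; rewrite ?gpredM ?actM.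
Qed.
Canonical orbit_rel_equiv :=
  EquivRel orbit_rel orbit_rel_refl orbit_rel_sym orbit_rel_trans.

Definition orbit_space := quotient_topology {eq_quot orbit_rel}.

HB.instance Definition _ := Topological.on orbit_space.

Definition cocompact : Prop := compact [set: orbit_space].

Definition torsion_free : Prop :=
  forall (g : PSL2 R) (n : nat),
    g \in Gamma -> (0 < n)%N -> (g ^+ n = 1 -> g = 1)%g.

Definition primitive (g : PSL2 R) : Prop :=
  [/\ g \in Gamma, g != 1%g &
      forall h n, h \in Gamma -> g = (h ^+ n)%g -> n = 1%N].

Definition conj_class (g : PSL2 R) : set (PSL2 R) :=
  [set (g ^ h)%g | h in [set` Gamma]].

Definition prim_classes : set (set (PSL2 R)) :=
  [set conj_class g | g in primitive].

End FuchsianGroup.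

Definition discrete_set {T : topologicalType} (A : set T) : Prop :=
  A `<=` isolated A.

(* All the quantities evaluated at [class_rep c] below are invariant under
   conjugation in Gamma, so the choice of representative is immaterial. *)
Definition class_rep {R : realType} (c : set (PSL2 R)) : PSL2 R := xget 1%g c.

Section Representations.
Variables (R : realType) (Gamma : groupClosed (PSL2 R)).

(* Homomorphisms defined on Gamma are given by functions on the whole of PSL2
   of which only the values on Gamma matter. *)
Definition teichmuller_rep (rho : PSL2 R -> PSL2 R) : Prop :=
  [/\ {in Gamma &, {morph rho : g h / (g * h)%g}},
      {in Gamma &, injective rho} &
      discrete_set (rho @` [set` Gamma])].

Variable V : vectType R[i].

(* The two equations force varrho g to be invertible for g in Gamma. *)
Definition linear_rep (varrho : PSL2 R -> 'End(V)) : Prop :=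
  varrho 1%g = \1%VF /\
  {in Gamma &, forall g h, varrho (g * h)%g = (varrho g \o varrho h)%VF}.

Definition lftrace (f : 'End(V)) : R[i] :=
  \tr (passmx.mxof (vbasis {:V}) (vbasis {:V}) f).

Definition is_norm (N : 'End(V) -> R) : Prop :=
  [/\ forall f, N f = 0 -> f = 0,
      forall (c : R[i]) f, N (c *: f) = Normc.normc c * N f &
      forall f g, N (f + g) <= N f + N g].

Definition teichmuller_type (varrho : PSL2 R -> 'End(V))
    (rho : PSL2 R -> PSL2 R) (beta : R) : Prop :=
  exists (N : 'End(V) -> R) (C : R), [/\ is_norm N, 0 < C &
    forall g, g \in Gamma ->
      N (varrho g) <= C * expR (beta * hdist (H2_i R) (act (rho g) (H2_i R)))
      /\ C^-1 * expR (beta * translation_length (rho g))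
           <= Normc.normc (lftrace (varrho g))
           <= C * expR (beta * translation_length (rho g))].

Definition crit_sum (varrho : PSL2 R -> 'End(V)) (s : R) : \bar R :=
  \esum_(p in prim_classes Gamma `*` [set k | (0 < k)%N])
    (Normc.normc (lftrace (varrho (class_rep p.1 ^+ p.2)%g))
     * expR (- s * p.2%:R * translation_length (class_rep p.1)))%:E.

Definition critical_exponent (varrho : PSL2 R -> 'End(V)) : \bar R :=
  ereal_inf [set s%:E | s in
    [set s : R | 0 < s /\ (crit_sum varrho s < +oo)%E]].

End Representations.

Section Manhattan.
Variables (R : realType) (Gamma : groupClosed (PSL2 R)).
Variable rho : PSL2 R -> PSL2 R.

Definition manhattan_sum (a b : R) : \bar R :=
  \esum_(p in prim_classes Gamma `*` [set k | (0 < k)%N])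
    (expR (- a * p.2%:R * translation_length (rho (class_rep p.1))
           - b * p.2%:R * translation_length (class_rep p.1)))%:E.

Definition manhattan_domain : set (R * R) :=
  [set ab | (manhattan_sum ab.1 ab.2 < +oo)%E].

Definition manhattan_curve : set (R * R) :=
  closure manhattan_domain `\` manhattan_domain°.

Definition length_ratio (c : set (PSL2 R)) : R :=
  translation_length (rho (class_rep c)) / translation_length (class_rep c).

Definition I_minus : \bar R :=
  ereal_inf [set (length_ratio c)%:E | c in prim_classes Gamma].

Definition I_plus : \bar R :=
  ereal_sup [set (length_ratio c)%:E | c in prim_classes Gamma].

End Manhattan.

(* Main.v *)
Require Import Defs.
From mathcomp Require Import all_boot all_order all_algebra.
From mathcomp Require Import all_classical all_reals all_analysis.
From mathcomp Require Import complex ring lra.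

(** Write [l] and [r] for the translation lengths, in [Gamma] and in [rho
   Gamma], of a class. By the trace bounds, the series defining [delta] is
   comparable with the Manhattan series on the line [a = - beta]. On the line
   [a = - 2 beta] the term of the [k]-th power of a class at height [b] has
   [k (2 beta r - b l) = k (beta r - (b - beta (r / l)) l)] as exponent, and
   [r / l] lies between [I_-] and [I_+]; hence the series at [(- 2 beta, b)] is at least the one
   at [(- beta, b - beta I_-)] and at most the one at [(- beta, b - beta
   I_+)]. Comparing the abscissas of convergence gives both inequalities.
   That the point of the curve over [- 2 beta] is such an abscissa requires
   [r / l] to be bounded: this follows from the existence of a point [(a, b)]
   with [a < 0] where the series converges, since the powers of a single
   class then give [a r + b l > 0]. The same estimate excludes classes with
   [l = 0].

   If [I_- = I_+ = 1], then [r = l], the Manhattan series at [(a, b)] is the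
   sum [length_sum] of [exp (- (a + b) k l)] over primitive classes and
   exponents [k >= 1], and it remains to see that its abscissa of convergence
   is [1]: this is [length_sum_lt_pinfty] and [length_sum_pinfty]. Both are
   obtained by comparison with the sum over [g] in [Gamma] of [cosh (d (i, g
   i)) ^ - s], whose abscissa is [1] because balls of radius [t] in the plane
   contain about [exp t] points of an orbit ([poincare_lt_pinfty],
   [poincare_pinfty]).

   - For convergence, each class has a member whose axis passes within
     bounded distance of [i], by cocompactness. It moves [i] by [l + O(1)],
     so the classes contribute less than the group elements do.
   - For divergence, every non-trivial element is conjugate to a power of the
     chosen representative of a primitive class ([primitive_root]). The
     members [h^-1 g h] of one class correspond to the orbit points [h i]
     modulo [g], and move [i] by about the length of [g] plus twice the
     distance from [h i] to the axis of [g]. The number of orbit points grows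
     like [exp] of that distance, so for [s > 1/2] the class contributes at
     most a multiple of [(l + 1) exp (- s l)] ([esum_conj_class]).

   The counting of orbit points behind the convergence statements is
   [esum_annulus]: in the upper half-plane a half-annulus [rho <= |w| <= e
   rho] is cut into boxes of bounded hyperbolic size, each of which contains
   a bounded number of orbit points. Distances enter through the rational
   function [cosh_dist], for which a weak triangle inequality suffices. *)

Set Implicit Arguments.
Unset Strict Implicit.
Unset Printing Implicit Defensive.

Import Order.TTheory GRing.Theory Num.Theory numFieldNormedType.Exports.

Local Open Scope classical_set_scope.
Local Open Scope quotient_scope.
Local Open Scope ring_scope.

(** * Sums of non-negative families *)

Section Esum.
Context {R : realType}.
Implicit Types T U : choiceType.

Lemma esum_subset T (A B : set T) (f : T -> \bar R) :
  A `<=` B -> (\esum_(t in A) f t <= \esum_(t in B) f t)%E.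
Proof.
move=> AB; apply: ereal_sup_le; apply: image_subset => F [finF FA].
by split=> // t /FA/AB.
Qed.

Lemma esum_fiber T U (A : set T) (B : set U) (k : T -> U) (f : T -> \bar R) :
  (forall t, A t -> B (k t)) -> (forall t, 0 <= f t)%E ->
  \esum_(t in A) f t =
  \esum_(u in B) \esum_(t in A `&` [set t | k t = u]) f t.
Proof.
move=> AB f0; rewrite esum_esum; last by move=> u t *; exact: f0.
rewrite (reindex_esum A _ (fun t => (k t, t))) //; split.
- by move=> t At; split=> //=; exact: AB.
- by move=> s t _ _ [].
- by move=> [u t] [/= Bu [At <-]]; exists t.
Qed.

Lemma le_esum_inj T U (A : set T) (B : set U) (e : T -> U)
    (f : T -> \bar R) (g : U -> \bar R) :
  (forall t, A t -> B (e t)) -> set_inj A e ->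
  (forall t, A t -> (f t <= g (e t))%E) ->
  (\esum_(t in A) f t <= \esum_(u in B) g u)%E.
Proof.
move=> AB inje fg; apply: (le_trans (le_esum fg)).
rewrite -(esum_image A e g inje); apply: esum_subset => _ [t At <-]; exact: AB.
Qed.

Lemma le_esumZ T (A : set T) (c : R) (f : T -> \bar R) :
  0 <= c -> (forall t, 0 <= f t)%E ->
  (\esum_(t in A) (c%:E * f t) <= c%:E * \esum_(t in A) f t)%E.
Proof.
move=> c0 f0; apply: ge_ereal_sup => _ [F [finF FA] <-].
rewrite -ge0_mule_fsumr //; apply: lee_wpmul2l; first by rewrite lee_fin.
by apply: ereal_sup_ubound; exists F.
Qed.

Lemma esum_bounded T (A : set T) (c N : R) (f : T -> \bar R) :
  0 <= c -> (forall t, A t -> (f t <= c%:E)%E) ->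
  (\esum_(t in A) 1 <= N%:E)%E -> (\esum_(t in A) f t <= (c * N)%:E)%E.
Proof.
move=> c0 fc AN; apply: (le_trans (le_esum (b := fun=> (c%:E * 1)%E) _)).
  by move=> t At; rewrite mule1; exact: fc.
apply: (le_trans (le_esumZ _ c0 _)) => //.
by rewrite EFinM; apply: lee_wpmul2l; rewrite ?lee_fin.
Qed.

Lemma esum_lt_pinfty T (A : set T) (c : R) (f : T -> \bar R) :
  (\esum_(t in A) f t <= c%:E)%E -> (\esum_(t in A) f t < +oo)%E.
Proof. by move=> /le_lt_trans; apply; rewrite ltry. Qed.

Lemma esum_setU_le (T : choiceType) (A B : set T) (f : T -> \bar R) :
  (forall t, 0 <= f t)%E ->
  (\esum_(t in A `|` B) f t <= \esum_(t in A) f t + \esum_(t in B) f t)%E.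
Proof.
move=> f0; rewrite (esumID A) //; apply: leeD; apply: esum_subset.
  by move=> t [].
by move=> t [[]].
Qed.

Lemma ge_esum_enum T (A : set T) (f : T -> \bar R) (n : nat) (e : nat -> T)
    (m : R) :
  (forall k, (k < n)%N -> A (e k)) -> {in `I_n &, injective e} ->
  (forall k, (k < n)%N -> (m%:E <= f (e k))%E) -> 0 <= m ->
  ((n%:R * m)%:E <= \esum_(t in A) f t)%E.
Proof.
move=> eA inje mf m0.
have -> : (n%:R * m)%:E = \esum_(k in `I_n) m%:E :> \bar R.
  rewrite esum_fset; [|exact: finite_II|by move=> *; rewrite lee_fin].
  rewrite -fsbig_ord /= sumEFin; congr (_%:E).
  by rewrite sumr_const card_ord mulr_natl.
by apply: (le_esum_inj (e := e)).
Qed.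

Lemma esum_ordinal (n : nat) : \esum_(k in `I_n) 1%E = n%:R%:E :> \bar R.
Proof.
rewrite esum_fset //.
by rewrite -fsbig_ord /= sumEFin sumr_const card_ord.
Qed.

Lemma esum_boxes (T : choiceType) (A : set T) (k : T -> nat) (n : nat) (N : R) :
  0 <= N -> (forall t, A t -> (k t < n)%N) ->
  (forall j, (\esum_(t in A `&` [set t | k t = j]) 1 <= N%:E)%E) ->
  (\esum_(t in A) 1 <= (N * n%:R)%:E)%E.
Proof.
move=> N0 kn kN; rewrite (esum_fiber (B := `I_n) (k := k)) //.
by apply: esum_bounded => //; rewrite esum_ordinal.
Qed.

Lemma esum_nat_le (f : nat -> \bar R) (B : \bar R) : (forall n, 0 <= f n)%E ->
  (forall n, \sum_(0 <= k < n) f k <= B)%E ->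
  (\esum_(k in [set: nat]) f k <= B)%E.
Proof.
move=> f0 fB; rewrite -nneseries_esumT //; apply: lime_le.
  by apply: is_cvg_nneseries.
by near=> n; exact: fB.
Unshelve. all: by end_near. Qed.

Lemma esum_geometric (q : R) : 0 <= q < 1 ->
  (\esum_(k in [set: nat]) (q ^+ k)%:E <= ((1 - q)^-1)%:E)%E.
Proof.
move=> /andP[q0 q1]; apply: esum_nat_le => [n|n].
  by rewrite lee_fin exprn_ge0.
have q1' : 0 < 1 - q by rewrite subr_gt0.
rewrite sumEFin lee_fin -[leRHS]mul1r ler_pdivlMr // mulrC.
have -> : \sum_(0 <= k < n) q ^+ k = \sum_(k < n) q ^+ k by rewrite big_mkord.
by rewrite -opprB mulNr -subrX1 opprB gerBl exprn_ge0.
Qed.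

End Esum.

(** * The hyperbolic cosine of the distance *)

Section CoshDistance.
Context {R : realType}.
Implicit Types (z w v : H2 R) (A B : SL2 R) (g h : PSL2 R).

Local Notation Re := complex.Re.
Local Notation Im := complex.Im.

Definition cosh_dist z w : R :=
  ((Re z - Re w) ^+ 2 + Im z ^+ 2 + Im w ^+ 2) / (2 * Im z * Im w).

Lemma Im_gt0 z : 0 < Im z.
Proof. by case: z. Qed.

Lemma hdistE z w : hdist z w = arcosh (cosh_dist z w).
Proof.
have := Im_gt0 z; have := Im_gt0 w; rewrite /hdist /cosh_dist.
case: z w => -[x y] /= _ [[x' y'] /= _] y0 y'0; congr arcosh.
rewrite sqr_sqrtr ?addr_ge0 ?sqr_ge0 //; field.
by rewrite ?gt_eqF.
Qed.

Lemma cosh_dist_sym z w : cosh_dist z w = cosh_dist w z.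
Proof.
have := Im_gt0 z; have := Im_gt0 w => y0 y'0.
by rewrite /cosh_dist; field; rewrite ?gt_eqF.
Qed.

Lemma cosh_dist_ge1 z w : 1 <= cosh_dist z w.
Proof.
have y0 := Im_gt0 z; have y'0 := Im_gt0 w; rewrite /cosh_dist.
rewrite ler_pdivlMr ?mulr_gt0 // mul1r -subr_ge0.
have -> : (Re z - Re w) ^+ 2 + Im z ^+ 2 + Im w ^+ 2 - 2 * Im z * Im w =
  (Re z - Re w) ^+ 2 + (Im z - Im w) ^+ 2 by ring.
by rewrite addr_ge0 ?sqr_ge0.
Qed.

Lemma cosh_dist_gt0 z w : 0 < cosh_dist z w.
Proof. by rewrite (lt_le_trans ltr01) // cosh_dist_ge1. Qed.

Lemma cosh_dist_eq1 z w : cosh_dist z w = 1 -> z = w.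
Proof.
have y0 := Im_gt0 z; have y'0 := Im_gt0 w; rewrite /cosh_dist.
move=> /(congr1 (fun r => r * (2 * Im z * Im w))).
rewrite mul1r divfK ?gt_eqF ?mulr_gt0 // => e.
have /eqP : (Re z - Re w) ^+ 2 + (Im z - Im w) ^+ 2 = 0.
  by apply/eqP; rewrite -(subr_eq0 _ 0) subr0; apply/eqP; move: e; lra.
rewrite paddr_eq0 ?sqr_ge0 // !sqrf_eq0 !subr_eq0 => /andP[/eqP rE /eqP iE].
apply: val_inj; case: z w rE iE {y0 y'0 e} => -[x y] /= _ [[x' y'] /= _].
by move=> -> ->.
Qed.

(** [cosh (s + t) <= 2 cosh s cosh t]: distances are only ever compared up to a
   bounded error, which is why this weak form of the triangle inequality
   suffices. *)
Lemma cosh_dist_triangle z w v :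
  cosh_dist z v <= 2 * cosh_dist z w * cosh_dist w v.
Proof.
have := Im_gt0 z; have := Im_gt0 w; have := Im_gt0 v; rewrite /cosh_dist.
move: (Re z) (Re w) (Re v) (Im z) (Im w) (Im v) => x1 x2 x3 y1 y2 y3 p3 p2 p1.
have -> : 2 * (((x1 - x2) ^+ 2 + y1 ^+ 2 + y2 ^+ 2) / (2 * y1 * y2)) *
    (((x2 - x3) ^+ 2 + y2 ^+ 2 + y3 ^+ 2) / (2 * y2 * y3)) =
    (((x1 - x2) ^+ 2 + y1 ^+ 2 + y2 ^+ 2) *
     ((x2 - x3) ^+ 2 + y2 ^+ 2 + y3 ^+ 2) / y2 ^+ 2) / (2 * y1 * y3).
  by field; rewrite ?gt_eqF.
rewrite ler_pM2r ?invr_gt0 ?mulr_gt0 // ler_pdivlMr ?exprn_gt0 //.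
rewrite -subr_ge0.
set p := x1 - x2; set q := x2 - x3.
have -> : x1 - x3 = p + q by rewrite /p /q; ring.
have -> : (p ^+ 2 + y1 ^+ 2 + y2 ^+ 2) * (q ^+ 2 + y2 ^+ 2 + y3 ^+ 2) -
    ((p + q) ^+ 2 + y1 ^+ 2 + y3 ^+ 2) * y2 ^+ 2 =
  (p * q - y2 ^+ 2) ^+ 2 + (p * y3) ^+ 2 + (y1 * q) ^+ 2 + (y1 * y3) ^+ 2.
  by ring.
by rewrite !addr_ge0 ?sqr_ge0.
Qed.

Lemma cosh_dist_triangle_le z w v (a b : R) :
  cosh_dist z w <= a -> cosh_dist w v <= b -> cosh_dist z v <= 2 * a * b.
Proof.
have p1 := cosh_dist_ge1 z w; have p2 := cosh_dist_ge1 w v.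
have := cosh_dist_triangle z w v.
move: (cosh_dist z w) (cosh_dist w v) (cosh_dist z v) p1 p2.
move=> x y t x1 y1 h xa yb.
apply: le_trans h _; rewrite -!mulrA ler_pM2l // ler_pM //; lra.
Qed.

Definition mobius_norm A z : R :=
  (A 1 0 * Re z + A 1 1) ^+ 2 + (A 1 0 * Im z) ^+ 2.

Lemma mobius_norm_gt0 A z : 0 < mobius_norm A z.
Proof.
have := mobius_den_neq0 A z; rewrite /mobius_norm /mobius_den.
case: z => -[x y] /= y0; rewrite real_lin_complex eq_complex /= => h.
rewrite lt_neqAle addr_ge0 ?sqr_ge0 // andbT eq_sym.
by rewrite paddr_eq0 ?sqr_ge0 // !sqrf_eq0.
Qed.

Lemma Im_mobius A z : Im (mobius A z) = Im z / mobius_norm A z.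
Proof.
have := mobius_norm_gt0 A z; have := mobius_det A; rewrite /mobius_norm.
case: z => -[x y] y0 det1; rewrite [Re _]/= [complex.Im _]/= => q0.
rewrite -[RHS]/(y / ((A 1 0 * x + A 1 1) ^+ 2 + (A 1 0 * y) ^+ 2)).
rewrite -[LHS]/(Im (mobius_num A (Complex x y) / mobius_den A (Complex x y))).
rewrite /mobius_num /mobius_den !real_lin_complex /=.
move: (A 0 0) (A 0 1) (A 1 0) (A 1 1) det1 q0 => a b c d det1 q0.
rewrite -[X in _ = X / _]mul1r -det1; field.
by rewrite gt_eqF.
Qed.

Lemma Re_mobius A z : Re (mobius A z) =
  ((A 0 0 * Re z + A 0 1) * (A 1 0 * Re z + A 1 1) +
   A 0 0 * A 1 0 * Im z ^+ 2) / mobius_norm A z.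
Proof.
have := mobius_norm_gt0 A z; rewrite /mobius_norm.
case: z => -[x y] y0; rewrite [Re _]/= [complex.Im _]/= => q0.
rewrite -[RHS]/(((A 0 0 * x + A 0 1) * (A 1 0 * x + A 1 1) +
   A 0 0 * A 1 0 * y ^+ 2) / ((A 1 0 * x + A 1 1) ^+ 2 + (A 1 0 * y) ^+ 2)).
rewrite -[LHS]/(Re (mobius_num A (Complex x y) / mobius_den A (Complex x y))).
rewrite /mobius_num /mobius_den !real_lin_complex /=.
by field; rewrite gt_eqF.
Qed.

Lemma cosh_dist_mobius A z w :
  cosh_dist (mobius A z) (mobius A w) = cosh_dist z w.
Proof.
have := mobius_norm_gt0 A z; have := mobius_norm_gt0 A w.
have := Im_gt0 z; have := Im_gt0 w; have := mobius_det A.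
rewrite /cosh_dist !Im_mobius !Re_mobius /mobius_norm.
move: (A 0 0) (A 0 1) (A 1 0) (A 1 1) (Re z) (Re w) (Im z) (Im w).
move=> a b c d x x' y y' det1 y'0 y0 q'0 q0.
set q := (c * x + d) ^+ 2 + (c * y) ^+ 2 in q0 *.
set q' := (c * x' + d) ^+ 2 + (c * y') ^+ 2 in q'0 *.
set X := _ + a * c * y ^+ 2; set X' := _ + a * c * y' ^+ 2.
transitivity (((X * q' - X' * q) ^+ 2 + (y * q') ^+ 2 + (y' * q) ^+ 2)
    / (2 * y * y' * (q * q'))).
  by field; rewrite ?gt_eqF.
have -> : (X * q' - X' * q) ^+ 2 + (y * q') ^+ 2 + (y' * q) ^+ 2 =
    ((x - x') ^+ 2 + y ^+ 2 + y' ^+ 2) * (q * q').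
  have -> : (X * q' - X' * q) ^+ 2 + (y * q') ^+ 2 + (y' * q) ^+ 2 =
    (X * q' - X' * q) ^+ 2 + ((a * d - b * c) * (y * q' - y' * q)) ^+ 2
    + 2 * y * y' * (q * q').
    by rewrite det1; ring.
  have -> : ((x - x') ^+ 2 + y ^+ 2 + y' ^+ 2) * (q * q') =
    (a * d - b * c) ^+ 2 * ((x - x') ^+ 2 + (y - y') ^+ 2) * (q * q') +
    2 * y * y' * (q * q').
    by rewrite det1; ring.
  by rewrite /X /X' /q /q'; ring.
by field; rewrite ?gt_eqF.
Qed.

Lemma cosh_dist_act g z w : cosh_dist (act g z) (act g w) = cosh_dist z w.
Proof. exact: cosh_dist_mobius. Qed.

(** This is [|p z| ^ 2 / (2 (Im z) ^ 2)] for [p = c X^2 + (d - a) X - b], the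
   polynomial whose roots are the fixed points of [A]; [|p z| ^ 2] is written so
   that the discriminant of [p] appears. *)
Definition displacement (A : 'M[R]_2) z : R :=
  ((A 1 0 * (Re z ^+ 2 + Im z ^+ 2) + (A 1 1 - A 0 0) * Re z - A 0 1) ^+ 2 +
   Im z ^+ 2 * ((A 0 0 - A 1 1) ^+ 2 + 4 * A 0 1 * A 1 0))
  / (2 * Im z ^+ 2).

Lemma cosh_dist_displacement A z :
  cosh_dist z (mobius A z) = 1 + displacement A z.
Proof.
have := mobius_norm_gt0 A z; have := Im_gt0 z; have := mobius_det A.
rewrite /cosh_dist Im_mobius Re_mobius /mobius_norm /displacement.
move: (A 0 0) (A 0 1) (A 1 0) (A 1 1) (Re z) (Im z).
move=> a b c d x y det1 y0 q0.
set q := (c * x + d) ^+ 2 + (c * y) ^+ 2 in q0 *.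
set X := _ + a * c * y ^+ 2; set N := _ + y ^+ 2 * _.
transitivity (((x * q - X) ^+ 2 + (y * q) ^+ 2 + y ^+ 2) / (2 * y ^+ 2 * q)).
  by field; rewrite ?gt_eqF.
have -> : (x * q - X) ^+ 2 + (y * q) ^+ 2 + y ^+ 2 = (2 * y ^+ 2 + N) * q.
  have -> : (x * q - X) ^+ 2 + (y * q) ^+ 2 + y ^+ 2 =
    (x * q - X) ^+ 2 + (y * q - (a * d - b * c) * y) ^+ 2 + 2 * y ^+ 2 * q.
    by rewrite det1; ring.
  by rewrite /X /N /q; ring.
by field; rewrite ?gt_eqF.
Qed.

(** The polynomial depends linearly on the matrix and vanishes on scalar
   matrices. *)
Lemma displacement_lin (A : 'M[R]_2) (u v : R) z :
  displacement (u *: A + v%:M) z = u ^+ 2 * displacement A z.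
Proof.
have y0 := Im_gt0 z; rewrite /displacement !mxE /=.
by rewrite !(mulr1n, mulr0n); field; rewrite gt_eqF.
Qed.

End CoshDistance.

(** * Powers in the special linear group *)

Section Powers.
Context {R : realType}.
Implicit Types (z w v : H2 R) (A B : SL2 R) (g h : PSL2 R).

Lemma PSL2_piM A B :
  \pi_(PSL2 R) (A * B)%g = (\pi_(PSL2 R) A * \pi_(PSL2 R) B)%g.
Proof. by rewrite -PSL2_mulE. Qed.

Lemma PSL2_piX A n : \pi_(PSL2 R) (A ^+ n)%g = (\pi_(PSL2 R) A ^+ n)%g.
Proof.
by elim: n => [|n IH]; rewrite ?expg0 // !expgS PSL2_piM IH.
Qed.

Lemma PSL2_piV A : \pi_(PSL2 R) (A^-1)%g = ((\pi_(PSL2 R) A)^-1)%g.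
Proof.
by apply: (@mulIg _ (\pi_(PSL2 R) A)); rewrite mulVg -PSL2_piM mulVg.
Qed.

Lemma ord2P (i : 'I_2) : i = 0 \/ i = 1.
Proof.
by case: i => -[|[|//]] ?; [left|right]; apply: val_inj.
Qed.

Lemma SL2_ext A B : (forall i j, A i j = B i j) -> A = B.
Proof. by move=> AB; apply: val_inj; apply/matrixP. Qed.

Lemma SL2_mulE A B (i j : 'I_2) :
  (A * B)%g i j = A i 0 * B 0 j + A i 1 * B 1 j.
Proof.
rewrite /= !mxE !big_ord_recl !big_ord0 addr0.
by have -> : lift ord0 ord0 = 1 :> 'I_2 by exact/val_inj.
Qed.

Definition SL2_trace A : R := A 0 0 + A 1 1.

Lemma SL2_cayley A (u v : R) :
  A *m (u *: (A : 'M[R]_2) - v%:M) =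
  (SL2_trace A * u - v) *: (A : 'M[R]_2) - u%:M.
Proof.
have det1 := mobius_det A.
apply/matrixP => i j.
rewrite !mxE !big_ord_recl !big_ord0 !mxE /SL2_trace.
have -> : lift ord0 ord0 = 1 :> 'I_2 by exact/val_inj.
case: (ord2P i) (ord2P j) => -> [->|->]; rewrite /= ?(mulr1n, mulr0n);
  have := congr1 ( *%R u) det1; lra.
Qed.

(** By the Cayley-Hamilton theorem a power of [A] is an affine combination of
   [A] and the identity. The coefficients satisfy a linear recurrence, which is
   expanding unless [A] is elliptic. *)
Lemma SL2_exp_affine A n : exists u v : R,
  SL2_mx (A ^+ n.+1)%g = u *: (A : 'M[R]_2) - v%:M /\
  (2 <= `|SL2_trace A| -> 1 <= `|u| - `|v|).
Proof.
elim: n => [|n [u [v [E uv]]]].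
  exists 1, 0; rewrite expg1 scale1r raddf0 subr0; split=> //.
  by rewrite normr1 normr0 subr0.
exists (SL2_trace A * u - v), u; rewrite expgS; split.
  by rewrite -SL2_cayley -E.
move=> t2; have {uv} := uv t2; have := lerB_normD (SL2_trace A * u) (- v).
rewrite normrN normrM.
have : 2 * `|u| <= `|SL2_trace A| * `|u| by rewrite ler_wpM2r.
lra.
Qed.

Lemma displacement_ge0 A z : 0 <= displacement A z.
Proof.
by have := cosh_dist_ge1 z (mobius A z); rewrite cosh_dist_displacement lerDl.
Qed.

(** A power displaces every point by the same multiple of what [A] does; the
   multiple is at least [1] unless [A] is elliptic. *)
Lemma displacement_exp A n : exists u : R,
  (2 <= `|SL2_trace A| -> 1 <= `|u|) /\
  forall z, displacement (A ^+ n.+1)%g z = u ^+ 2 * displacement A z.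
Proof.
have [u [v [-> uv]]] := SL2_exp_affine A n; exists u; split.
  by move=> /uv; have := normr_ge0 v; lra.
by move=> z; rewrite -raddfN displacement_lin.
Qed.

End Powers.

(** * The inverse hyperbolic cosine *)

Section Arcosh.
Context {R : realType}.
Implicit Types x y L : R.

Definition coshR L : R := (expR L + expR (- L)) / 2.

Lemma expRVN L : expR L * expR (- L) = 1.
Proof. by rewrite -expRD subrr expR0. Qed.

Lemma le_arcosh x y : 1 <= x -> x <= y -> arcosh x <= arcosh y.
Proof.
move=> x1 xy; rewrite /arcosh ler_ln ?posrE.
- by apply: lerD => //; rewrite ler_wsqrtr // lerB // lerXn2r ?nnegrE; lra.
- by rewrite ltr_wpDr ?sqrtr_ge0 //; lra.
- by rewrite ltr_wpDr ?sqrtr_ge0 //; lra.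
Qed.

Lemma arcosh_ge0 x : 1 <= x -> 0 <= arcosh x.
Proof.
by move=> x1; rewrite /arcosh ln_ge0 // ler_wpDr ?sqrtr_ge0.
Qed.

Lemma arcosh_coshR L : 0 <= L -> arcosh (coshR L) = L.
Proof.
move=> L0; rewrite /arcosh.
have e : coshR L ^+ 2 - 1 = ((expR L - expR (- L)) / 2) ^+ 2.
  by have := expRVN L; rewrite /coshR; lra.
have h : 0 <= (expR L - expR (- L)) / 2.
  by rewrite divr_ge0 // subr_ge0 ler_expR; lra.
rewrite e sqrtr_sqr ger0_norm //.
by rewrite -[RHS]expRK; congr ln; rewrite /coshR; lra.
Qed.

Lemma coshR_ge1 L : 1 <= coshR L.
Proof.
rewrite /coshR ler_pdivlMr // mul1r -subr_ge0.
have -> : expR L + expR (- L) - 2 =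
    (expR (L / 2) - expR (- (L / 2))) ^+ 2.
  have e1 : expR L = expR (L / 2) ^+ 2 by rewrite -expRM_natl; congr expR; field.
  have e2 : expR (- L) = expR (- (L / 2)) ^+ 2.
    by rewrite -expRM_natl; congr expR; field.
  by have := expRVN (L / 2); rewrite e1 e2; lra.
exact: sqr_ge0.
Qed.

Lemma coshR_gt1 L : 0 < L -> 1 < coshR L.
Proof.
move=> L0; rewrite lt_neqAle coshR_ge1 andbT; apply/eqP => e.
have := arcosh_coshR (ltW L0); rewrite -e /arcosh expr1n subrr sqrtr0 addr0 ln1.
by move=> e0; rewrite e0 ltxx in L0.
Qed.

Lemma coshR_sub1_ge (e L : R) : 0 < e -> e <= L ->
  (1 - expR (- e)) ^+ 2 / 2 * expR L <= coshR L - 1.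
Proof.
move=> e0 eL; rewrite /coshR.
have -> : (expR L + expR (- L)) / 2 - 1 = (1 - expR (- L)) ^+ 2 / 2 * expR L.
  by have := expRVN L; have := congr1 ( *%R (expR (- L))) (expRVN L); lra.
rewrite ler_pM2r ?expR_gt0 // ler_pM2r //.
have h : expR (- L) <= expR (- e) by rewrite ler_expR lerN2.
have : expR (- e) <= 1 by rewrite -expR0 ler_expR; lra.
by move=> h1; rewrite lerXn2r ?nnegrE; lra.
Qed.

End Arcosh.

(** * Translation lengths *)

Section TranslationLength.
Context {R : realType}.
Implicit Types (z w v : H2 R) (A B : SL2 R) (g h : PSL2 R) (L : R).

Local Notation Re := complex.Re.
Local Notation Im := complex.Im.

Lemma actKV g z : act g (act g^-1%g z) = z.
Proof. by rewrite -actM mulgV act1. Qed.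

Lemma actK g z : act g^-1%g (act g z) = z.
Proof. by rewrite -actM mulVg act1. Qed.

Lemma translation_length_has_lbound g :
  has_lbound [set hdist z (act g z) | z in [set: H2 R]].
Proof.
by exists 0 => _ [z _ <-]; rewrite hdistE arcosh_ge0 ?cosh_dist_ge1.
Qed.

Lemma translation_length_ge g L : (forall z, L <= hdist z (act g z)) ->
  L <= translation_length g.
Proof.
move=> gL; apply: lb_le_inf.
  by exists (hdist (H2_i R) (act g (H2_i R))); exists (H2_i R).
by move=> _ [z _ <-].
Qed.

Lemma translation_length_le g z : translation_length g <= hdist z (act g z).
Proof. by apply: ge_inf; [exact: translation_length_has_lbound | exists z]. Qed.

Lemma translation_length_ge0 g : 0 <= translation_length g.
Proof.
by apply: translation_length_ge => z; rewrite hdistE arcosh_ge0 ?cosh_dist_ge1.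
Qed.

Lemma translation_lengthJ g h :
  translation_length (g ^ h)%g = translation_length g.
Proof.
have le g' h' : translation_length g' <= translation_length (g' ^ h')%g.
  apply: translation_length_ge => z.
  rewrite hdistE conjgE !actM -(cosh_dist_act h') actKV -hdistE.
  exact: translation_length_le.
apply: le_anti; rewrite (le g h) andbT.
by have := le (g ^ h)%g (h^-1)%g; rewrite conjgK.
Qed.

Fact dilation_subproof L :
  \det (\matrix_(i < 2, j < 2) (if i == j then expR (if i == 0 then L / 2
    else - (L / 2)) else 0)) == 1 :> R.
Proof.
rewrite (expand_det_row _ 0) !big_ord_recl big_ord0.
rewrite /cofactor !det_mx11 !mxE /= mul0r !addr0 expr0 mul1r.
by rewrite expRVN.
Qed.

Definition dilation L : PSL2 R := \pi_(PSL2 R) (MkSL2 (dilation_subproof L)).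

Lemma Re_act_dilation L z : Re (act (dilation L) z) = expR L * Re z.
Proof.
rewrite act_pi Re_mobius /mobius_norm !mxE /= !mul0r !addr0 !add0r.
rewrite mulr0 mul0r addr0 expr0n addr0.
have e : expR L = expR (L / 2) ^+ 2 by rewrite -expRM_natl; congr expR; field.
have := expRVN (L / 2); rewrite e => e1.
have n0 : expR (- (L / 2)) != 0 by rewrite gt_eqF // expR_gt0.
apply: (mulIf (expf_neq0 2 n0)); rewrite divfK ?expf_neq0 //.
have := congr1 ( *%R (expR (L / 2) * Re z * expR (- (L / 2)))) e1; lra.
Qed.

Lemma Im_act_dilation L z : Im (act (dilation L) z) = expR L * Im z.
Proof.
rewrite act_pi Im_mobius /mobius_norm !mxE /= !mul0r !add0r expr0n addr0.
have e : expR L = expR (L / 2) ^+ 2 by rewrite -expRM_natl; congr expR; field.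
have := expRVN (L / 2); rewrite e => e1.
have n0 : expR (- (L / 2)) != 0 by rewrite gt_eqF // expR_gt0.
apply: (mulIf (expf_neq0 2 n0)); rewrite divfK ?expf_neq0 //.
have : (expR (L / 2) * expR (- (L / 2))) ^+ 2 = 1 by rewrite e1 expr1n.
by move=> /(congr1 ( *%R (Im z))); lra.
Qed.

Definition cmod z : R := Num.sqrt (Re z ^+ 2 + Im z ^+ 2).

Lemma cosh_dist_dilation L z : cosh_dist z (act (dilation L) z) =
  1 + (coshR L - 1) * (cmod z / Im z) ^+ 2.
Proof.
have y0 := Im_gt0 z; rewrite /cosh_dist Re_act_dilation Im_act_dilation.
rewrite expr_div_n sqr_sqrtr ?addr_ge0 ?sqr_ge0 // /coshR expRN.
have eL : expR L != 0 by rewrite gt_eqF // expR_gt0.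
by field; rewrite eL gt_eqF.
Qed.

Lemma cmod_gt0 z : 0 < cmod z.
Proof.
by rewrite sqrtr_gt0 ltr_wpDl ?sqr_ge0 // exprn_gt0 // Im_gt0.
Qed.

Lemma Im_le_cmod z : Im z <= cmod z.
Proof.
rewrite -(ger0_norm (ltW (Im_gt0 z))) -sqrtr_sqr ler_wsqrtr //.
by rewrite lerDr sqr_ge0.
Qed.

Lemma Re_le_cmod z : `|Re z| <= cmod z.
Proof. by rewrite -sqrtr_sqr ler_wsqrtr // lerDl sqr_ge0. Qed.

Lemma cmod_act_dilation (L : R) z : cmod (act (dilation L) z) = expR L * cmod z.
Proof.
rewrite /cmod Re_act_dilation Im_act_dilation !exprMn -mulrDr.
by rewrite sqrtrM ?exprn_ge0 ?expR_ge0 // sqrtr_sqr ger0_norm ?expR_ge0.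
Qed.

Lemma H2_i_cmod : cmod (H2_i R) = 1.
Proof. by rewrite /cmod /= expr0n /= add0r expr1n sqrtr1. Qed.

Lemma translation_length_dilation L : 0 <= L ->
  translation_length (dilation L) = L.
Proof.
move=> L0; apply/eqP; rewrite eq_le; apply/andP; split.
  apply: le_trans (translation_length_le _ (H2_i R)) _.
  rewrite hdistE cosh_dist_dilation H2_i_cmod /= divr1 expr1n mulr1 addrC.
  by rewrite subrK arcosh_coshR.
apply: translation_length_ge => z.
rewrite hdistE cosh_dist_dilation -{1}(arcosh_coshR L0).
apply: le_arcosh; first exact: coshR_ge1.
rewrite -lerBlDl ler_peMr ?subr_ge0 ?coshR_ge1 //.
by rewrite exprn_ege1 // ler_pdivlMr ?Im_gt0 // mul1r Im_le_cmod.
Qed.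

Lemma dilationD L L' : dilation (L + L') = (dilation L * dilation L')%g.
Proof.
rewrite /dilation -PSL2_piM; congr (\pi_(PSL2 R) _); apply: SL2_ext => i j.
rewrite SL2_mulE /= !mxE.
by case: (ord2P i) (ord2P j) => -> [->|->];
  rewrite /= ?mul0r ?mulr0 ?addr0 ?add0r // -expRD; congr expR; lra.
Qed.

Lemma dilation0 : dilation 0 = 1%g.
Proof. by apply: (@mulgI _ (dilation 0)); rewrite -dilationD addr0 mulg1. Qed.

Lemma dilationX L n : (dilation L ^+ n)%g = dilation (n%:R * L).
Proof.
elim: n => [|n IH]; first by rewrite expg0 mul0r dilation0.
by rewrite expgS IH -dilationD -natr1 mulrDl mul1r addrC.
Qed.

End TranslationLength.

(** * Classification of isometries *)

Section Classification.
Context {R : realType}.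
Implicit Types (z w v : H2 R) (A B : SL2 R) (g h : PSL2 R) (L : R).

Local Notation Re := complex.Re.
Local Notation Im := complex.Im.

Definition mkH2 (x y : R) (y0 : 0 < y) : H2 R := @MkH2 R (Complex x y) y0.

Lemma SL2_of_entries (a b c d : R) : a * d - b * c = 1 ->
  exists A, [/\ A 0 0 = a, A 0 1 = b, A 1 0 = c & A 1 1 = d].
Proof.
move=> det1.
pose M : 'M[R]_2 := \matrix_(i, j)
  (if i == 0 then if j == 0 then a else b else if j == 0 then c else d).
have detM : \det M == 1.
  rewrite (expand_det_row _ 0) !big_ord_recl big_ord0.
  by rewrite /cofactor !det_mx11 !mxE /= expr0 expr1; apply/eqP; lra.
by exists (MkSL2 detM); rewrite /= !mxE.
Qed.

(** The rows [(p, q)] and [(r, s)] are left eigenvectors of [A]; normalised to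
   determinant [1] they form the conjugating matrix. The sign [sg] is that of
   the trace of [A] and disappears in the projective group. *)
Lemma conj_dilation_of_eigenrows A L (sg p q r s : R) :
  sg ^+ 2 = 1 ->
  let l := expR (L / 2) in let l' := expR (- (L / 2)) in
  p * s - q * r != 0 ->
  p * A 0 0 + q * A 1 0 = sg * l * p -> p * A 0 1 + q * A 1 1 = sg * l * q ->
  r * A 0 0 + s * A 1 0 = sg * l' * r -> r * A 0 1 + s * A 1 1 = sg * l' * s ->
  exists h, \pi_(PSL2 R) A = (dilation L ^ h)%g.
Proof.
move=> sg1 l l' D0 e1 e2 e3 e4.
have [|E [E00 E01 E10 E11]] := @SL2_of_entries (p / (p * s - q * r))
  (q / (p * s - q * r)) r s.
  by field.
exists (\pi_(PSL2 R) E); rewrite conjgE; apply: (@mulgI _ (\pi_(PSL2 R) E)).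
rewrite mulVKg -!PSL2_piM; apply/PSL2_eqP.
have H i j : (E * A)%g i j = sg * (MkSL2 (dilation_subproof L) * E)%g i j.
  rewrite !SL2_mulE.
  have f1 := congr1 ( *%R^~ (p * s - q * r)^-1) e1.
  have f2 := congr1 ( *%R^~ (p * s - q * r)^-1) e2.
  move: f1 f2 E00 E01; rewrite /=; set k := (p * s - q * r)^-1.
  move=> f1 f2 E00 E01.
  by case: (ord2P i) (ord2P j) => -> [->|->]; rewrite !mxE /=
    ?E00 ?E01 ?E10 ?E11 -/l -/l'; lra.
have := congr1 (fun x => x - 1) sg1; rewrite subrr -{1}(expr1n _ 2) subr_sqr.
move=> /eqP; rewrite mulf_eq0 subr_eq0 addr_eq0 => /orP[]/eqP sgE;
  apply/orP; [left|right]; apply/eqP/matrixP => i j; have := H i j;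
  rewrite sgE ?mul1r ?mulN1r => ->; by rewrite ?mxE.
Qed.

Lemma hyperbolic_conj_dilation A : 2 < `|SL2_trace A| ->
  exists2 L, 0 < L & exists h, \pi_(PSL2 R) A = (dilation L ^ h)%g.
Proof.
move=> t2; have det1 := mobius_det A.
(* The eigenvalues of [A] are [sg * l] and [sg * l'] with [l l' = 1]. *)
pose sg := Num.sg (SL2_trace A).
have sg1 : sg ^+ 2 = 1.
  by rewrite /sg sqr_sg -normr_gt0 (lt_trans _ t2).
pose l := (`|SL2_trace A| + Num.sqrt (SL2_trace A ^+ 2 - 4)) / 2.
pose l' := (`|SL2_trace A| - Num.sqrt (SL2_trace A ^+ 2 - 4)) / 2.
have t4 : 0 < SL2_trace A ^+ 2 - 4.
  by rewrite subr_gt0 -(real_normK (num_real _)); nra.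
have s0 : 0 < Num.sqrt (SL2_trace A ^+ 2 - 4) by rewrite sqrtr_gt0.
have s2 := sqr_sqrtr (ltW t4).
have tn : SL2_trace A = sg * `|SL2_trace A| by rewrite /sg -numEsg.
have tn2 : `|SL2_trace A| ^+ 2 = SL2_trace A ^+ 2 by rewrite real_normK ?num_real.
have ll' : l * l' = 1 by rewrite /l /l'; lra.
have lDl' : sg * l + sg * l' = SL2_trace A by rewrite [RHS]tn /l /l'; lra.
have l1 : 1 < l by rewrite /l; lra.
have l0 : 0 < l by lra.
have lVl' : l' = l^-1.
  by apply: (mulfI (lt0r_neq0 l0)); rewrite ll' mulfV ?gt_eqF.
have nll' : l - l' != 0 by rewrite /l /l' gt_eqF //; lra.
have sg0 : sg != 0 by apply/eqP => e; move: sg1; rewrite e; lra.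
exists (2 * ln l); first by rewrite mulr_gt0 // ln_gt0.
have eL : 2 * ln l / 2 = ln l by field.
have el : l = expR (2 * ln l / 2) by rewrite eL lnK // posrE.
have el' : l' = expR (- (2 * ln l / 2)) by rewrite eL expRN lnK // posrE.
have prod1 : sg * l * (sg * l') = 1 by rewrite mulrACA ll' mulr1 -expr2.
move: det1 lDl' prod1; rewrite /SL2_trace.
have dif : sg * l - sg * l' != 0 by rewrite -mulrBr mulf_neq0.
move=> det1 tr1 prod1.
have mk p q r s := @conj_dilation_of_eigenrows A (2 * ln l) sg p q r s sg1.
move: mk; rewrite -el -el' /=.
set mu := sg * l in tr1 prod1 dif *; set nu := sg * l' in tr1 prod1 dif *.
move: (A 0 0) (A 0 1) (A 1 0) (A 1 1) det1 tr1 => a b c d det1 tr1 mk.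
have [c0|c0] := eqVneq c 0; last first.
  have mn := congr1 ( *%R mu) tr1; have nn := congr1 ( *%R nu) tr1.
  apply: (mk c (mu - a) c (nu - a)); try lra.
  have -> : c * (nu - a) - (mu - a) * c = - (c * (mu - nu)) by ring.
  by rewrite oppr_eq0 mulf_neq0.
rewrite {}c0 in det1 mk *.
have : (a - mu) * (a - nu) = 0.
  by have := congr1 ( *%R a) tr1; move: det1 prod1; lra.
move=> /eqP; rewrite mulf_eq0 !subr_eq0 => /orP[]/eqP aE.
  have dE : d = nu by lra.
  by apply: (mk (mu - d) b 0 1); rewrite ?aE ?dE; lra.
have dE : d = mu by lra.
by apply: (mk 0 1 (nu - d) b); rewrite ?aE ?dE; lra.
Qed.

(** The points above [(a - d) / (2 c)], the midpoint of the fixed points of [A]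
   in the complex plane. *)
Lemma displacement_over_midpoint A (s : R) : 0 < s -> A 1 0 != 0 ->
  exists z, displacement A z =
    (s ^+ 2 + (SL2_trace A ^+ 2 - 4) / 4) ^+ 2 / (2 * s ^+ 2).
Proof.
move=> s0 c0; have y0 : 0 < s / `|A 1 0| by rewrite divr_gt0 // normr_gt0.
exists (@mkH2 ((A 0 0 - A 1 1) / (2 * A 1 0)) _ y0).
have det1 := mobius_det A.
rewrite /displacement /=.
have -> : (s / `|A 1 0|) ^+ 2 = s ^+ 2 / A 1 0 ^+ 2.
  by rewrite expr_div_n real_normK ?num_real.
rewrite /SL2_trace.
have -> : (A 0 0 + A 1 1) ^+ 2 - 4 = (A 0 0 - A 1 1) ^+ 2 + 4 * A 0 1 * A 1 0.
  by lra.
by field; rewrite c0 gt_eqF.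
Qed.

Lemma elliptic_fixpoint A : `|SL2_trace A| < 2 -> exists z, mobius A z = z.
Proof.
move=> t2.
have D0 : 0 < 4 - SL2_trace A ^+ 2.
  rewrite subr_gt0 -(real_normK (num_real _)).
  by have := normr_ge0 (SL2_trace A); nra.
have det1 := mobius_det A.
have c0 : A 1 0 != 0.
  apply/eqP => c0; move: D0 det1; rewrite /SL2_trace c0.
  by have := sqr_ge0 (A 0 0 - A 1 1); lra.
have s0 : 0 < Num.sqrt ((4 - SL2_trace A ^+ 2) / 4) by rewrite sqrtr_gt0 divr_gt0.
have [z zE] := displacement_over_midpoint s0 c0; exists z.
apply/esym/cosh_dist_eq1; rewrite cosh_dist_displacement zE.
rewrite sqr_sqrtr; last by rewrite divr_ge0 // ltW.
by rewrite -mulrDl addrA subrK subrr mul0r expr0n mul0r addr0.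
Qed.

Lemma nonhyperbolic_displacement A (e : R) : `|SL2_trace A| <= 2 -> 0 < e ->
  exists z, displacement A z <= e.
Proof.
move=> t2 e0.
have D0 : 0 <= 4 - SL2_trace A ^+ 2.
  rewrite subr_ge0 -(real_normK (num_real _)).
  by have := normr_ge0 (SL2_trace A); nra.
have det1 := mobius_det A.
have [c0|c0] := eqVneq (A 1 0) 0; last first.
  have s0 : 0 < Num.sqrt (e + (4 - SL2_trace A ^+ 2) / 4).
    by rewrite sqrtr_gt0; lra.
  have [z zE] := displacement_over_midpoint s0 c0; exists z; rewrite zE.
  rewrite sqr_sqrtr; last by lra.
  set D := 4 - _ in D0 *.
  have -> : SL2_trace A ^+ 2 - 4 = - D by rewrite /D; ring.
  rewrite ler_pdivrMr; last by lra.
  have -> : (e + D / 4 + - D / 4) = e by ring.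
  by have : 0 <= e * D by [rewrite mulr_ge0 // ltW]; have := sqr_ge0 e; lra.
have y0 : 0 < 1 + A 0 1 ^+ 2 / e.
  by rewrite ltr_wpDr // divr_ge0 ?sqr_ge0 // ltW.
exists (mkH2 0 y0); rewrite /displacement /= c0.
have aEd : A 0 0 - A 1 1 = 0.
  apply/eqP; rewrite -sqrf_eq0 eq_le sqr_ge0 andbT.
  by move: D0 det1; rewrite /SL2_trace c0; lra.
have -> : A 1 1 = A 0 0 by lra.
rewrite ler_pdivrMr ?mulr_gt0 ?exprn_gt0 //.
have q0 : 0 <= A 0 1 ^+ 2 / e by rewrite divr_ge0 ?sqr_ge0 // ltW.
have : A 0 1 ^+ 2 = e * (A 0 1 ^+ 2 / e) by field; rewrite gt_eqF.
move: (A 0 1 ^+ 2 / e) q0 => q q0 bE.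
have e1 : 0 <= e * q by rewrite mulr_ge0 // ltW.
have e2 : 0 <= e * q * q by rewrite mulr_ge0.
by lra.
Qed.

Lemma hyperbolic_or_nonhyperbolic g :
  (exists2 L, 0 < L & exists h, g = (dilation L ^ h)%g) \/
  (exists2 A, g = \pi_(PSL2 R) A & `|SL2_trace A| <= 2).
Proof.
have [A ->] := PSL2P g; have [t2|t2] := leP `|SL2_trace A| 2.
  by right; exists A.
by left; apply: hyperbolic_conj_dilation.
Qed.

Lemma translation_length_eq0 A :
  (forall e, 0 < e -> exists z, displacement A z <= e) ->
  translation_length (\pi_(PSL2 R) A) = 0.
Proof.
move=> dA; apply/eqP; rewrite eq_le translation_length_ge0 andbT.
rewrite leNgt; apply/negP; set t := translation_length _ => t0.
have l0 : 0 < t / 2 by rewrite divr_gt0.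
have [|z zA] := dA (coshR (t / 2) - 1); first by rewrite subr_gt0 coshR_gt1.
have := translation_length_le (\pi_(PSL2 R) A) z.
rewrite hdistE act_pi cosh_dist_displacement -/t.
have : arcosh (1 + displacement A z) <= arcosh (coshR (t / 2)).
  by apply: le_arcosh; [rewrite lerDl displacement_ge0|lra].
by rewrite (arcosh_coshR (ltW l0)); lra.
Qed.

(** For a hyperbolic element both sides are read off the conjugate dilation. The
   other elements have points with arbitrarily small displacement, and by
   [displacement_exp] so do their powers. *)
Lemma translation_lengthX g n :
  translation_length (g ^+ n)%g = n%:R * translation_length g.
Proof.
case: n => [|n].
  by rewrite expg0 mul0r -dilation0 translation_length_dilation.
have [[L L0 [h ->]]|[A -> tA]] := hyperbolic_or_nonhyperbolic g.
  rewrite -conjXg !translation_lengthJ dilationX.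
  by rewrite !translation_length_dilation ?mulr_ge0 // ltW.
have dA e := @nonhyperbolic_displacement A e tA.
rewrite -PSL2_piX !translation_length_eq0 ?mulr0 // => e e0.
have [u [_ uA]] := displacement_exp A n.
have [|z zA] := dA (e / (u ^+ 2 + 1)).
  by rewrite divr_gt0 // ltr_wpDl ?sqr_ge0.
exists z; rewrite uA; apply: (@le_trans _ _ ((u ^+ 2 + 1) * displacement A z)).
  by rewrite ler_wpM2r ?displacement_ge0 // lerDl.
by rewrite mulrC -ler_pdivlMr // ltr_wpDl ?sqr_ge0.
Qed.

Lemma hyperbolic_normal_form g : 0 < translation_length g ->
  exists h, g = (dilation (translation_length g) ^ h)%g.
Proof.
have [[L L0 [h ->]] _|[A -> tA]] := hyperbolic_or_nonhyperbolic g.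
  by exists h; rewrite translation_lengthJ translation_length_dilation // ltW.
rewrite translation_length_eq0 ?ltxx // => e; exact: nonhyperbolic_displacement.
Qed.

End Classification.

(** * Discrete and cocompact groups *)

Lemma finite_of_inj (T U : Type) (S : set T) (k : T -> U) :
  {in S &, injective k} -> finite_set (k @` S) -> finite_set S.
Proof. by move=> kinj; rewrite (eq_finite_set (inj_card_eq kinj)). Qed.

Lemma finite_set_nat_ub (V : set nat) : finite_set V ->
  exists b, forall n, V n -> (n <= b)%N.
Proof.
move=> fV; exists (\max_(i <- finmap.enum_fset (fset_set V)) i)%N => n Vn.
by apply: leq_bigmax_seq => //; rewrite in_fset_set // inE.
Qed.

Section Discrete.
Context {R : realType}.
Implicit Types (z w v : H2 R) (A B : SL2 R) (g h : PSL2 R).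

Local Notation Re := complex.Re.
Local Notation Im := complex.Im.

Lemma nbhs_PSL2 A (V : set (PSL2 R)) : nbhs (\pi_(PSL2 R) A) V ->
  exists2 e : R, 0 < e & forall B, (forall i j, `|A i j - B i j| < e) ->
    V (\pi_(PSL2 R) B).
Proof.
rewrite nbhsE => -[U [oU UA] UV].
have [W oW WU] : open (\pi_(PSL2 R) @^-1` U : set (SL2 R)) by [].
have : nbhs (SL2_mx A) W.
  apply: open_nbhs_nbhs; split=> //.
  by have : (@SL2_mx R @^-1` W) A by rewrite WU.
move=> /nbhs_ballP[e e0 eW]; exists e => // B AB; apply: UV.
suff : (@SL2_mx R @^-1` W) B by rewrite WU.
by apply: eW; split=> // i j; exact: AB.
Qed.

Lemma SL2_invE A : [/\ (A^-1)%g 0 0 = A 1 1, (A^-1)%g 0 1 = - A 0 1,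
  (A^-1)%g 1 0 = - A 1 0 & (A^-1)%g 1 1 = A 0 0].
Proof.
have det1 := mobius_det A.
have [|C [C00 C01 C10 C11]] :=
    @SL2_of_entries R (A 1 1) (- A 0 1) (- A 1 0) (A 0 0).
  by rewrite -det1; ring.
suff -> : (A^-1)%g = C by [].
apply: mulg1_eq; apply: SL2_ext => i j; rewrite SL2_mulE !mxE.
by case: (ord2P i) (ord2P j) => -> [->|->]; rewrite ?C00 ?C01 ?C10 ?C11 /=; lra.
Qed.

Lemma cosh_dist_mobius_i A : cosh_dist (H2_i R) (mobius A (H2_i R)) =
  (A 0 0 ^+ 2 + A 0 1 ^+ 2 + A 1 0 ^+ 2 + A 1 1 ^+ 2) / 2.
Proof.
rewrite cosh_dist_displacement /displacement /=.
by have := mobius_det A; lra.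
Qed.

Lemma entry_bound A (r : R) i j : 1 <= r ->
  cosh_dist (H2_i R) (mobius A (H2_i R)) <= r -> `|A i j| <= 2 * r.
Proof.
move=> r1; rewrite cosh_dist_mobius_i => h.
rewrite -(@ler_pXn2r _ 2) ?nnegrE //; last by rewrite mulr_ge0 //; lra.
rewrite real_normK ?num_real //.
have := sqr_ge0 (A 0 0); have := sqr_ge0 (A 0 1).
have := sqr_ge0 (A 1 0); have := sqr_ge0 (A 1 1).
have : r <= r ^+ 2 by rewrite expr2 ler_peMr //; lra.
by case: (ord2P i) (ord2P j) => -> [->|->]; lra.
Qed.

(** Group elements moving the base point by a bounded amount have lifts with
   bounded entries, and lifts lying in the same cell of a fine enough grid
   differ by a factor close to the identity. *)
Lemma discrete_finite (Gamma : groupClosed (PSL2 R)) (r : R) :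
  discrete_set [set` Gamma] ->
  finite_set [set g | g \in Gamma /\ cosh_dist (H2_i R) (act g (H2_i R)) <= r].
Proof.
move=> dG; wlog r1 : r / 1 <= r.
  move=> fin; apply: (sub_finite_set _ (fin (`|r| + 1) _)).
    move=> g [gG gr]; split=> //; apply: (le_trans gr).
    by apply: (le_trans (ler_norm r)); rewrite lerDl.
  by rewrite lerDr.
have /dG : (1%g : PSL2 R) \in Gamma by exact: gpred1.
rewrite /isolated inE => -[_ [V nV VG]].
have [e e0 eV] := @nbhs_PSL2 (SL2_one R) V nV.
have sep A : \pi_(PSL2 R) A \in Gamma ->
    (forall i j, `|SL2_one R i j - A i j| < e) -> \pi_(PSL2 R) A = 1%g.
  by move=> AG /eV VA; have : (V `&` [set` Gamma]) (\pi A) by []; rewrite VG.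
(* The entries are bounded by [2 r], and an entry of [(repr g)^-1 * repr h -
   1] is a sum of two products of such an entry with a difference of entries. *)
pose d := e / (8 * r); have d0 : 0 < d by rewrite divr_gt0 // mulr_gt0 //; lra.
pose cell g (i j : 'I_2) := Num.truncn ((repr g i j + 2 * r) / d).
pose k g := (cell g 0 0, cell g 0 1, (cell g 1 0, cell g 1 1)).
set S := [set g | _].
pose K := (Num.truncn (4 * r / d)).+1.
have bnd g i j : S g -> `|repr g i j| <= 2 * r.
  by move=> [_ gr]; apply: entry_bound.
have arg_ge0 g i j : S g -> 0 <= (repr g i j + 2 * r) / d.
  move=> Sg; have := bnd g i j Sg; rewrite ler_norml => /andP[h _].
  by rewrite divr_ge0 ?(ltW d0) //; lra.
have kK g i j : S g -> (cell g i j < K)%N.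
  move=> Sg; rewrite /cell /K ltnS truncn_le_nat.
  have := bnd g i j Sg; rewrite ler_norml => /andP[_ h].
  apply: le_lt_trans (truncnS_gt (4 * r / d)).
  by rewrite ler_pM2r ?invr_gt0 //; lra.
have kinj : {in S &, injective k}.
  move=> g h /[!inE] Sg Sh [e00 e01 e10 e11].
  have close i j : `|repr h i j - repr g i j| < d.
    have cE : cell g i j = cell h i j.
      by case: (ord2P i) (ord2P j) => -> [->|->].
    have := truncn_itv (arg_ge0 g i j Sg); have := truncn_itv (arg_ge0 h i j Sh).
    rewrite -/(cell g i j) -/(cell h i j) cE => /andP[h1 h2] /andP[h3 h4].
    have : `|(repr h i j + 2 * r) / d - (repr g i j + 2 * r) / d| < 1.
      by move: h2 h4; rewrite -!natr1 => h2 h4; rewrite ltr_norml; lra.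
    rewrite -mulrBl normrM (gtr0_norm (x := d^-1)) ?invr_gt0 //.
    by rewrite ltr_pdivrMr // mul1r; congr (`|_| < _); ring.
  suff : (g^-1 * h)%g = 1%g by move=> /mulg1_eq; rewrite invgK.
  have -> : (g^-1 * h)%g = \pi_(PSL2 R) ((repr g)^-1 * repr h)%g.
    by rewrite PSL2_piM PSL2_piV !reprK.
  apply: sep.
    rewrite PSL2_piM PSL2_piV !reprK.
    by move: Sg Sh => [gG _] [hG _]; rewrite gpredM // gpredV.
  have small x1 x2 y1 y2 : `|x1| <= 2 * r -> `|x2| <= 2 * r ->
      `|y1| < d -> `|y2| < d -> `|x1 * y1 + x2 * y2| < e.
    move=> hx1 hx2 hy1 hy2; apply: (le_lt_trans (ler_normD _ _)).
    rewrite !normrM.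
    have h1 : `|x1| * `|y1| <= 2 * r * d by rewrite ler_pM // ltW.
    have h2 : `|x2| * `|y2| <= 2 * r * d by rewrite ler_pM // ltW.
    have : 8 * r * d = e by rewrite /d; field; rewrite gt_eqF //; lra.
    lra.
  have det1 := mobius_det (repr g).
  have [i00 i01 i10 i11] := SL2_invE (repr g).
  have b i j := bnd g i j Sg; have c i j := close i j.
  have bN x : `|x| <= 2 * r -> `|- x| <= 2 * r by rewrite normrN.
  move=> i j; rewrite distrC SL2_mulE.
  case: (ord2P i) (ord2P j) => -> [->|->]; rewrite ?i00 ?i01 ?i10 ?i11 !mxE /=.
  - have -> : repr g 1 1 * repr h 0 0 + - repr g 0 1 * repr h 1 0 - 1 =
      repr g 1 1 * (repr h 0 0 - repr g 0 0) +
      - repr g 0 1 * (repr h 1 0 - repr g 1 0) by rewrite -det1; ring.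
    by apply: small => //; apply: bN.
  - have -> : repr g 1 1 * repr h 0 1 + - repr g 0 1 * repr h 1 1 - 0 =
      repr g 1 1 * (repr h 0 1 - repr g 0 1) +
      - repr g 0 1 * (repr h 1 1 - repr g 1 1) by ring.
    by apply: small => //; apply: bN.
  - have -> : - repr g 1 0 * repr h 0 0 + repr g 0 0 * repr h 1 0 - 0 =
      - repr g 1 0 * (repr h 0 0 - repr g 0 0) +
      repr g 0 0 * (repr h 1 0 - repr g 1 0) by ring.
    by apply: small => //; apply: bN.
  - have -> : - repr g 1 0 * repr h 0 1 + repr g 0 0 * repr h 1 1 - 1 =
      - repr g 1 0 * (repr h 0 1 - repr g 0 1) +
      repr g 0 0 * (repr h 1 1 - repr g 1 1) by rewrite -det1; ring.
    by apply: small => //; apply: bN.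
have finK : finite_set (`I_K `*` `I_K `*` (`I_K `*` `I_K)).
  by do 3? apply: finite_setX; exact: finite_II.
apply: (finite_of_inj kinj); apply: sub_finite_set finK => _ [g Sg <-].
by do ?split; apply: kK.
Qed.

(** The sets [N n] of points at bounded distance from the orbit are invariant,
   open and increasing. If none of them were the whole plane, the images of
   their complements would generate a proper filter, and a cluster point of
   it in the quotient would lie in the image of some [N n]. *)
Lemma cocompact_net (Gamma : groupClosed (PSL2 R)) : cocompact Gamma ->
  exists2 r : R, 1 <= r &
    forall z, exists2 g, g \in Gamma & cosh_dist z (act g (H2_i R)) <= r.
Proof.
move=> cG.
pose N (n : nat) := [set z : H2 R | exists2 g, g \in Gamma &
  cosh_dist z (act g (H2_i R)) < n%:R].
have NS m n : (m <= n)%N -> N m `<=` N n.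
  by move=> mn z [g gG zg]; exists g => //; rewrite (lt_le_trans zg) ?ler_nat.
have [[n Nn]|noN] := pselect (exists n, N n = [set: H2 R]).
  exists (n%:R + 1); first by rewrite lerDr.
  move=> z; have [g gG zg] : N n z by rewrite Nn.
  by exists g => //; apply: ltW; rewrite (lt_trans zg) // ltrDl.
have oN n : open (N n).
  have -> : N n = \bigcup_(g in [set` Gamma])
      [set z | cosh_dist z (act g (H2_i R)) < n%:R].
    by apply/seteqP; split => [z [g gG zg]|z [g gG zg]]; exists g.
  apply: bigcup_open => g _; move: (act _ _) => w.
  exists [set p : R * R | (p.1 - Re w) ^+ 2 + p.2 ^+ 2 + Im w ^+ 2
                          - n%:R * (2 * p.2 * Im w) < 0].
    apply: (@open_comp _ _ _ [set x : R | x < 0]); last exact: open_lt.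
    move=> p _; apply: cvgB.
      apply: cvgD; last exact: cvg_cst.
      by apply: cvgD; apply: cvgM; try apply: cvgB;
        try exact: cvg_fst; try exact: cvg_snd; exact: cvg_cst.
    apply: cvgMr; apply: cvgMl; apply: cvgMr; exact: cvg_snd.
  apply/seteqP; split=> z /=; rewrite /cosh_dist;
    have z0 := Im_gt0 z; have w0 := Im_gt0 w;
    by rewrite ltr_pdivrMr ?mulr_gt0 // subr_lt0.
pose F := filter_from [set: nat] (fun n => \pi_(orbit_space Gamma) @` (~` N n)).
have FF : ProperFilter F.
  apply: filter_from_proper.
    apply: filter_from_filter; first by exists 0%N.
    move=> m n _ _; exists (maxn m n) => // _ [z zN <-].
    split; exists z => // zN'; apply: zN.
      exact: (NS _ _ (leq_maxl m n)).
    exact: (NS _ _ (leq_maxr m n)).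
  move=> n _; apply/set0P/eqP => e0; apply: noN; exists n.
  apply/seteqP; split=> // z _; apply: contrapT => zN.
  by have : set0 (\pi_(orbit_space Gamma) z); [rewrite -e0; exists z|].
have [q [_ qF]] := cG F FF filterT.
have [z qE] : exists z, q = \pi_(orbit_space Gamma) z.
  by exists (repr q); rewrite reprK.
pose n := (Num.truncn (cosh_dist z (H2_i R))).+1.
have inv m : \pi_(orbit_space Gamma) @^-1` (\pi_(orbit_space Gamma) @` (N m)) = N m.
  apply/seteqP; split=> v; last by move=> vN; exists v.
  move=> [u [g gG ug] /eqmodP /asboolP[h hG ->]].
  exists (h * g)%g; first by rewrite gpredM.
  by rewrite actM cosh_dist_act.
have nq : nbhs q (\pi_(orbit_space Gamma) @` (N n)).
  apply: open_nbhs_nbhs; split.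
    have : open (\pi_(orbit_space Gamma) @^-1`
      (\pi_(orbit_space Gamma) @` (N n))) by rewrite inv; exact: oN.
    by [].
  rewrite qE; exists z => //; exists 1%g; first exact: gpred1.
  by rewrite act1 truncnS_gt.
have FN : F (\pi_(orbit_space Gamma) @` (~` N n)) by exists n.
have [_ [[v vN <-] vN']] := qF _ _ FN nq.
have : (\pi_(orbit_space Gamma) @^-1` (\pi_(orbit_space Gamma) @` (N n))) v.
  by [].
by rewrite inv.
Qed.

End Discrete.

(** * Primitive roots *)

Section Roots.
Context {R : realType}.
Implicit Types (z w v : H2 R) (A B : SL2 R) (g h : PSL2 R).
Context (Gamma : groupClosed (PSL2 R)).
Context (Gamma_discrete : discrete_set [set` Gamma]).
Context (Gamma_torsion_free : torsion_free Gamma).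

Lemma expg_collision g m n : g \in Gamma -> (g ^+ m = g ^+ n)%g -> m != n ->
  g = 1%g.
Proof.
move=> gG; wlog mn : m n / (m < n)%N.
  move=> H E; rewrite neq_ltn => /orP[mn|nm].
    by apply: (H m n) => //; rewrite ltn_eqF.
  by apply: (H n m) => //; rewrite ltn_eqF.
move=> E _; apply: (Gamma_torsion_free gG (n := (n - m)%N)).
  by rewrite subn_gt0.
by rewrite (expgnFr _ (ltnW mn)) E mulgV.
Qed.

(** The powers of an element with a fixed point move the base point by a bounded
   amount, hence are finite in number. *)
Lemma elliptic_eq1 A : \pi_(PSL2 R) A \in Gamma -> `|SL2_trace A| < 2 ->
  \pi_(PSL2 R) A = 1%g.
Proof.
set g := \pi_(PSL2 R) A => gG /elliptic_fixpoint[z zE].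
have gz n : act (g ^+ n)%g z = z.
  elim: n => [|n IH]; first by rewrite expg0 act1.
  by rewrite expgS actM IH act_pi.
apply: contrapT => g1; apply: infinite_nat.
apply: (@finite_of_inj _ _ _ (fun n => (g ^+ n)%g)).
  move=> m n _ _ E; apply/eqP/negP => /negP mn; apply: g1.
  exact: expg_collision E mn.
apply: sub_finite_set (discrete_finite
  (2 * cosh_dist (H2_i R) z * cosh_dist (H2_i R) z) Gamma_discrete).
move=> _ [n _ <-]; split; first exact: gpredXn.
apply: le_trans (cosh_dist_triangle _ z _) _.
have := cosh_dist_act (g ^+ n)%g z (H2_i R); rewrite gz => ->.
by rewrite [cosh_dist z _]cosh_dist_sym.
Qed.

(** A root of a non-elliptic element moves every point at most as far as the
   element itself, so that discreteness leaves only finitely many roots. *)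
Lemma primitive_root g : g \in Gamma -> g != 1%g ->
  exists h n, [/\ primitive Gamma h, (0 < n)%N & g = (h ^+ n)%g].
Proof.
move=> gG g1.
(* A root with the largest possible exponent is primitive. *)
pose V := [set n : nat | (0 < n)%N /\ exists2 h, h \in Gamma & g = (h ^+ n)%g].
have : forall n, exists h, V n -> h \in Gamma /\ g = (h ^+ n)%g.
  move=> n; have [[_ [h hG hE]]|nV] := pselect (V n); first by exists h.
  by exists 1%g.
move=> /choice[rt rtP].
have rt1 n : V n -> rt n != 1%g.
  move=> /rtP[_ E]; apply: contra g1 => /eqP e.
  by rewrite E e expg1n.
have [b bV] : exists b, forall n, V n -> (n <= b)%N.
  apply: finite_set_nat_ub; apply: (@finite_of_inj _ _ _ rt).
    move=> m n /[!inE] Vm Vn E; apply/eqP/negP => /negP mn.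
    have [rG rE] := rtP m Vm; have [_ rE'] := rtP n Vn.
    have := rt1 m Vm; apply/negP; rewrite negbK; apply/eqP.
    by apply: (@expg_collision _ m n) => //; rewrite -rE E.
  apply: sub_finite_set (discrete_finite
    (cosh_dist (H2_i R) (act g (H2_i R))) Gamma_discrete).
  move=> _ [n Vn <-]; have [rG rE] := rtP n Vn; split => //.
  have [A AE] := PSL2P (rt n).
  have tA : 2 <= `|SL2_trace A|.
    rewrite leNgt; apply/negP => tA; have := rt1 n Vn.
    by rewrite AE elliptic_eq1 ?eqxx // -AE.
  have n0 : (0 < n)%N by case: Vn.
  rewrite rE AE -(prednK n0) -PSL2_piX !act_pi !cosh_dist_displacement.
  have [u [u1 ->]] := displacement_exp A n.-1.
  rewrite lerD2l ler_peMl ?displacement_ge0 //.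
  by rewrite -(real_normK (num_real u)) exprn_ege1 // u1.
have V1 : `[< V 1 >] by apply/asboolP; split=> //; exists g; rewrite ?expg1.
have exV : exists n, (fun n => `[< V n >]) n by exists 1%N.
have [n /asboolP Vn nmax] :=
  ex_maxnP exV (fun n => fun h : `[< V n >] => bV n (asboolW h)).
have [rG rE] := rtP n Vn.
exists (rt n), n; split=> //; last by case: Vn.
split=> //; first exact: rt1.
move=> h m hG hE.
have m0 : (0 < m)%N.
  by rewrite lt0n; apply: contra (rt1 n Vn) => /eqP m0; rewrite hE m0 expg0.
have n0 : (0 < n)%N by case: Vn.
have : `[< V (m * n)%N >].
  apply/asboolP; split; first by rewrite muln_gt0 m0.
  by exists h => //; rewrite expgnA -hE.
move=> /nmax; rewrite -{2}(mul1n n) leq_pmul2r // => m1.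
by apply/eqP; rewrite eqn_leq m1.
Qed.

End Roots.

(** * Sums over sparse families of points *)

Section Sparse.
Context {R : realType}.
Implicit Types (z w v p : H2 R) (g h : PSL2 R).

(** Points are counted by sums of ones, so that counts and weighted sums are
   governed by the same lemmas. The bound is uniform in the centre [p], which
   makes it invariant under isometries. *)
Definition sparse (T : choiceType) (S : set T) (w : T -> H2 R) (r N : R) :=
  forall p,
    (\esum_(t in S `&` [set t | (cosh_dist p (w t) <= r)%R]) 1 <= N%:E)%E.

(** Two orbit points in a common ball differ by an element moving the base point
   by a bounded amount, whatever the centre of the ball. *)
Lemma orbit_sparse (Gamma : groupClosed (PSL2 R)) (r : R) :
  discrete_set [set` Gamma] ->
  exists N, 0 <= N /\
    forall h, sparse [set` Gamma] (fun g => act h (act g (H2_i R))) r N.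
Proof.
move=> /(@discrete_finite R Gamma (2 * r * r)); set F := [set g | _] => finF.
have FE : \esum_(t in F) 1%E =
    (\sum_(t <- finmap.enum_fset (fset_set F)) 1)%:E :> \bar R.
  by rewrite esum_fset // fsbig_finite //= sumEFin.
exists (\sum_(t <- finmap.enum_fset (fset_set F)) 1); split.
  by rewrite -lee_fin -FE esum_ge0.
move=> h p; set S := _ `&` _.
have [->|/set0P[g0 [g0G g0p]]] := eqVneq S set0.
  by rewrite esum_set0 -FE esum_ge0.
have pS g : S g -> cosh_dist (act h^-1%g p) (act g (H2_i R)) <= r.
  by move=> [_]; rewrite /= -(cosh_dist_act h^-1%g) actK.
have {}g0p := pS g0 (conj g0G g0p).
rewrite -FE; apply: (le_esum_inj (e := fun g => (g0^-1 * g)%g)) => //.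
  move=> g Sg; have gp := pS g Sg; have [gG _] := Sg.
  split; first by rewrite gpredM // gpredV.
  by rewrite actM -(cosh_dist_act g0) actKV; apply: cosh_dist_triangle_le gp;
    rewrite cosh_dist_sym.
by move=> g g' _ _ /mulgI.
Qed.

Lemma sparse_ge0 (T : choiceType) (S : set T) (w : T -> H2 R) (r N : R) :
  sparse S w r N -> 0 <= N.
Proof.
move=> /(_ (H2_i R)); rewrite -lee_fin; apply: le_trans.
by rewrite esum_ge0.
Qed.

Local Notation Re := complex.Re.
Local Notation Im := complex.Im.

(** The reciprocal of the hyperbolic cosine of the distance from [w] to the
   imaginary axis. *)
Definition axis_slope w : R := Im w / cmod w.

Lemma axis_slope_gt0 w : 0 < axis_slope w.
Proof. by rewrite divr_gt0 ?Im_gt0 ?cmod_gt0. Qed.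

Lemma axis_slope_ge0 w : 0 <= axis_slope w.
Proof. exact/ltW/axis_slope_gt0. Qed.

Lemma axis_slope_le1 w : axis_slope w <= 1.
Proof. by rewrite ler_pdivrMr ?cmod_gt0 // mul1r Im_le_cmod. Qed.

Lemma cosh_dist_same_box w v (h : R) : 0 < h -> h <= Im w -> h <= Im v ->
  Im w <= expR 2 * h -> Im v <= expR 2 * h -> `|Re w - Re v| <= h ->
  cosh_dist w v <= 1 + expR 4.
Proof.
move=> h0 w1 v1 w2 v2 wv; have w0 := Im_gt0 w; have v0 := Im_gt0 v.
rewrite /cosh_dist ler_pdivrMr ?mulr_gt0 //.
have hh : h * h <= Im w * Im v by rewrite ler_pM // ltW.
have e4 : expR 4 = expR 2 * expR 2 :> R by rewrite -expRD; congr expR; ring.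
have x2 : (Re w - Re v) ^+ 2 <= h ^+ 2.
  by rewrite -(real_normK (num_real _)) lerXn2r ?nnegrE // ltW.
have q (y : R) : 0 < y -> y <= expR 2 * h -> y ^+ 2 <= expR 4 * (h * h).
  move=> y0 yh; have : y ^+ 2 <= (expR 2 * h) ^+ 2.
    by rewrite lerXn2r ?nnegrE ?(ltW y0) // (le_trans (ltW y0)).
  by rewrite e4; lra.
have e0 : 0 < expR 4 :> R by exact: expR_gt0.
have := q _ w0 w2; have := q _ v0 v2.
have : expR 4 * (h * h) <= expR 4 * (Im w * Im v) by rewrite ler_pM2l.
by have := mulr_gt0 w0 v0; lra.
Qed.

(** Points of the half-annulus [rho <= |w| <= e rho] at height comparable with
   [e^-j rho] lie in about [e^j] boxes of bounded diameter, each of which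
   contains at most [N] of them. *)
Lemma esum_annulus (s : R) : 1 < s -> exists2 C : R, 0 <= C &
  forall (T : choiceType) (S : set T) (w : T -> H2 R) (N rho : R),
  sparse S w (1 + expR 4) N -> 0 < rho ->
  (\esum_(t in S `&` [set t | (rho <= cmod (w t) <= expR 1 * rho)%R])
    (axis_slope (w t) `^ s)%:E <= (C * N)%:E)%E.
Proof.
move=> s1; pose q : R := expR (1 - s).
have q01 : 0 <= q < 1 by rewrite expR_ge0 /= -[1 in ltRHS]expR0 ltr_expR; lra.
exists (3 * expR 2 * (1 - q)^-1).
  by rewrite mulr_ge0 ?invr_ge0 ?mulr_ge0 ?expR_ge0 //; lra.
move=> T S w N rho sp rho0; have N0 := sparse_ge0 sp.
set A := _ `&` _.
pose level t := Num.truncn (- ln (axis_slope (w t))).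
rewrite (esum_fiber (B := setT) (k := level)) //; last first.
  by move=> t; rewrite lee_fin powR_ge0.
have levelP t :
    expR (- (level t).+1%:R) <= axis_slope (w t) <= expR (- (level t)%:R).
  have u0 := axis_slope_gt0 (w t).
  have : 0 <= - ln (axis_slope (w t)) by rewrite oppr_ge0 ln_le0 ?axis_slope_le1.
  move=> /truncn_itv; rewrite -/(level t) => /andP[h1 h2].
  by rewrite -(lnK u0) !ler_expR; apply/andP; split; lra.
apply: (@le_trans _ _ (\esum_(j in [set: nat])
    ((3 * expR 2 * N)%:E * (q ^+ j)%:E)%E)); last first.
  apply: (le_trans (le_esumZ _ _ _)).
  - by rewrite !mulr_ge0 ?expR_ge0.
  - by move=> j; rewrite lee_fin exprn_ge0 //; case/andP: q01.
  apply: le_trans (lee_wpmul2l _ (esum_geometric q01)) _.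
    by rewrite lee_fin !mulr_ge0 ?expR_ge0.
  by rewrite -EFinM lee_fin [leRHS]mulrAC.
apply: le_esum => j _; rewrite -EFinM.
(* Points of level [j] in the half-annulus have height between [h] and
   [expR 2 * h]; boxes of width [h] are numbered from the left end of the
   half-annulus. *)
pose h := rho * expR (- j.+1%:R).
have h0 : 0 < h by rewrite mulr_gt0 ?expR_gt0.
pose box t := Num.truncn ((Re (w t) + expR 1 * rho) / h).
pose M := (Num.truncn (2 * expR (j%:R + 2) : R)).+1.
have ImP t : (A `&` [set t | level t = j]) t -> h <= Im (w t) <= expR 2 * h.
  move=> [[_ /= /andP[r1 r2]] /= tj]; have := levelP t; rewrite tj => /andP[l1 l2].
  have -> : Im (w t) = axis_slope (w t) * cmod (w t).
    by rewrite divfK // gt_eqF // cmod_gt0.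
  apply/andP; split.
    by rewrite /h mulrC ler_pM ?expR_ge0 // ltW.
  have -> : expR 2 * h = expR (- j%:R) * (expR 1 * rho).
    have : expR 2 * expR (- j.+1%:R) = expR (- j%:R) * expR 1 :> R.
      by rewrite -!expRD; congr expR; rewrite -natr1; ring.
    by move=> /(congr1 ( *%R rho)); rewrite /h; lra.
  by rewrite ler_pM ?(ltW (axis_slope_gt0 _)) ?(ltW (cmod_gt0 _)).
have ReP t : A t -> 0 <= (Re (w t) + expR 1 * rho) / h <= 2 * expR (j%:R + 2).
  move=> [_ /= /andP[_ r2]]; have := le_trans (Re_le_cmod (w t)) r2.
  rewrite ler_norml => /andP[x1 x2]; apply/andP; split.
    by rewrite divr_ge0 ?(ltW h0) //; lra.
  rewrite ler_pdivrMr // /h.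
  have -> : 2 * expR (j%:R + 2) * (rho * expR (- j.+1%:R)) = 2 * (expR 1 * rho).
    have -> : expR 1 = expR (j%:R + 2) * expR (- j.+1%:R) :> R.
      by rewrite -expRD; congr expR; rewrite -natr1; ring.
    by ring.
  by lra.
have cnt : (\esum_(t in A `&` [set t | level t = j]) 1 <= (N * M%:R)%:E)%E.
  apply: (esum_boxes (k := box)) => //.
    move=> t [/ReP/andP[x0 x1] _]; rewrite ltnS truncn_le_nat.
    by apply: le_lt_trans x1 (truncnS_gt _).
  move=> m; set B := _ `&` _.
  have [->|/set0P[t0 Bt0]] := eqVneq B set0; first by rewrite esum_set0 lee_fin.
  apply: le_trans (sp (w t0)); apply: esum_subset => t Bt; split.
    by case: Bt => -[[]].
  have [[At0 _] /= b0] := Bt0; have [[At _] /= b1] := Bt.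
  have /andP[i1 i2] := ImP t0 Bt0.1; have /andP[i3 i4] := ImP t Bt.1.
  apply: (cosh_dist_same_box h0) => //.
  have /andP[x0 _] := ReP _ At0; have /andP[y0 _] := ReP _ At.
  have := truncn_itv x0; have := truncn_itv y0.
  rewrite -/(box t) -/(box t0) b0 b1 => /andP[t1 t2] /andP[t3 t4].
  have : `|(Re (w t0) + expR 1 * rho) / h - (Re (w t) + expR 1 * rho) / h| <= 1.
    by move: t2 t4; rewrite -!natr1 => t2 t4; rewrite ler_norml; lra.
  rewrite -mulrBl normrM (gtr0_norm (x := h^-1)) ?invr_gt0 //.
  by rewrite ler_pdivrMr // mul1r; congr (`|_| <= _); ring.
apply: le_trans (esum_bounded (c := expR (- j%:R) `^ s) _ _ cnt) _.
- exact: powR_ge0.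
- move=> t [_ /= tj]; rewrite lee_fin; have := levelP t; rewrite tj => /andP[_ l2].
  by rewrite ge0_ler_powR ?nnegrE ?expR_ge0 ?(ltW (axis_slope_gt0 _)) //; lra.
have M3 : M%:R <= 3 * expR (j%:R + 2) :> R.
  have := truncn_itv (_ : 0 <= 2 * expR (j%:R + 2) :> R).
  rewrite mulr_ge0 ?expR_ge0 // => /(_ isT)/andP[h1 _].
  rewrite /M -natr1; have : 1 <= expR (j%:R + 2) :> R.
    by rewrite -expR0 ler_expR addr_ge0.
  by lra.
rewrite lee_fin -expRM -expRM_natl.
apply: (@le_trans _ _ (expR (- j%:R * s) * (N * (3 * expR (j%:R + 2))))).
  by rewrite ler_wpM2l ?expR_ge0 // ler_wpM2l.
have -> : expR (j%:R * (1 - s)) = expR (- j%:R * s) * expR j%:R :> R.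
  by rewrite -expRD; congr expR; ring.
by rewrite expRD; lra.
Qed.

End Sparse.

(** * The orbital series *)

Section Poincare.
Context {R : realType}.
Implicit Types (z w v p : H2 R) (g h : PSL2 R).
Context (Gamma : groupClosed (PSL2 R)).

Local Notation Re := complex.Re.
Local Notation Im := complex.Im.
Local Notation i0 := (H2_i R).

(** Up to a bounded factor this is [exp (- s d (i, g i))]. *)
Definition orbit_weight (s : R) g : R := (cosh_dist i0 (act g i0))^-1 `^ s.

Definition poincare (s : R) : \bar R :=
  \esum_(g in [set` Gamma]) (orbit_weight s g)%:E.

(** The distance from [i] to [w] is, up to a bounded error, the sum of the
   distance from [w] to the imaginary axis and of the distance from [i] to
   the projection [|w| i] of [w]. *)
Lemma cosh_dist_i_inv w : (cosh_dist i0 w)^-1 <=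
  axis_slope w * (2 * expR (- `|ln (cmod w)|)).
Proof.
have m0 := cmod_gt0 w; have y0 := Im_gt0 w.
have m2 : cmod w ^+ 2 = Re w ^+ 2 + Im w ^+ 2.
  by rewrite sqr_sqrtr // addr_ge0 ?sqr_ge0.
have q0 : 0 < cmod w ^+ 2 + 1 by rewrite ltr_wpDl ?sqr_ge0.
have -> : (cosh_dist i0 w)^-1 =
    axis_slope w * (2 * (cmod w / (cmod w ^+ 2 + 1))).
  have -> : cosh_dist i0 w = (cmod w ^+ 2 + 1) / (2 * Im w).
    by rewrite m2 /cosh_dist /= sub0r sqrrN expr1n mulr1 addrAC.
  by rewrite /axis_slope; field; rewrite ?gt_eqF.
rewrite ler_pM2l ?axis_slope_gt0 // ler_pM2l //.
have [l0|l0] := leP 0 (ln (cmod w)).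
  rewrite ger0_norm // expRN lnK // ler_pdivrMr // mulrC ler_pdivlMr //.
  by rewrite -expr2 lerDl.
rewrite ltr0_norm // opprK lnK // ler_pdivrMr //.
by rewrite ler_peMr ?(ltW m0) // lerDr sqr_ge0.
Qed.

(** The orbit points with [|w|] about [e^k] or [e^-k] contribute at most a
   multiple of [e^(- k s)] times the sum estimated in [esum_annulus]. *)
Lemma poincare_lt_pinfty (s : R) : discrete_set [set` Gamma] -> 1 < s ->
  (poincare s < +oo)%E.
Proof.
move=> dG s1.
have [N [N0 sp]] := orbit_sparse (1 + expR 4) dG.
have [C C0 annC] := esum_annulus s1.
pose w g := act g i0.
have {}sp : sparse [set` Gamma] w (1 + expR 4) N.
  move=> p; apply: le_trans (sp 1%g p); apply: esum_subset => g [gG gp].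
  by split=> //=; rewrite act1.
pose k g := Num.truncn `|ln (cmod (w g))|.
pose q : R := expR (- s).
have q01 : 0 <= q < 1 by rewrite expR_ge0 /= -[1 in ltRHS]expR0 ltr_expR; lra.
have ow0 g : (0 <= (orbit_weight s g)%:E)%E by rewrite lee_fin powR_ge0.
rewrite /poincare (esum_fiber (B := setT) (k := k)) //.
apply: (@esum_lt_pinfty _ _ _ (2 `^ s * (C * N + C * N) * (1 - q)^-1)).
apply: (@le_trans _ _ (\esum_(j in [set: nat])
    ((2 `^ s * (C * N + C * N))%:E * (q ^+ j)%:E)%E)); last first.
  have c0 : 0 <= 2 `^ s * (C * N + C * N).
    by rewrite mulr_ge0 ?powR_ge0 // addr_ge0 // mulr_ge0.
  apply: (le_trans (le_esumZ _ c0 _)).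
    by move=> j; rewrite lee_fin exprn_ge0 //; case/andP: q01.
  rewrite [leRHS]EFinM; apply: lee_wpmul2l; first by rewrite lee_fin.
  exact: esum_geometric.
apply: le_esum => j _.
pose A1 := [set` Gamma] `&`
  [set g | expR j%:R <= cmod (w g) <= expR 1 * expR j%:R].
pose A2 := [set` Gamma] `&`
  [set g | expR (- j.+1%:R) <= cmod (w g) <= expR 1 * expR (- j.+1%:R)].
apply: (@le_trans _ _ (\esum_(g in A1 `|` A2)
    ((2 `^ s * q ^+ j)%:E * (axis_slope (w g) `^ s)%:E)%E)).
  apply: (@le_trans _ _ (\esum_(g in [set` Gamma] `&` [set g | k g = j])
      ((2 `^ s * q ^+ j)%:E * (axis_slope (w g) `^ s)%:E)%E)).
    apply: le_esum => g [gG /= gj]; rewrite -EFinM lee_fin.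
    have -> : 2 `^ s * q ^+ j * axis_slope (w g) `^ s =
        (axis_slope (w g) * (2 * expR (- j%:R))) `^ s.
      have u0 := axis_slope_ge0 (w g).
      have e0 : 0 <= 2 * expR (- j%:R) :> R by rewrite mulr_ge0 ?expR_ge0.
      rewrite (powRM _ u0 e0) (powRM _ (ler0n R 2) (expR_ge0 _)).
      by rewrite -expRM_natl -expRM mulrN mulNr mulrC.
    apply: ge0_ler_powR; rewrite ?nnegrE ?invr_ge0
      ?(ltW (cosh_dist_gt0 _ _)) //; first lra.
      by apply: mulr_ge0; rewrite ?axis_slope_ge0 // mulr_ge0 ?expR_ge0.
    apply: le_trans (cosh_dist_i_inv (w g)) _.
    rewrite ler_pM2l ?axis_slope_gt0 // ler_pM2l // ler_expR lerN2 -gj.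
    by have /truncn_itv/andP[] := normr_ge0 (ln (cmod (w g))).
  apply: esum_subset => g [gG /= gj].
  have /truncn_itv := normr_ge0 (ln (cmod (w g))); rewrite -/(k g) gj.
  have m0 := cmod_gt0 (w g).
  have [l0|l0] := leP 0 (ln (cmod (w g))).
    rewrite ger0_norm // => /andP[h1 h2]; left; split=> //=.
    rewrite -expRD -(lnK m0) !ler_expR h1 /=; move: h2; rewrite -natr1; lra.
  rewrite ltr0_norm // => /andP[h1 h2]; right; split=> //=.
  by rewrite -expRD -(lnK m0) !ler_expR; move: h2; rewrite -natr1; lra.
apply: (le_trans (esum_setU_le _ _ _)) => [g|].
  by rewrite -EFinM lee_fin !mulr_ge0 ?powR_ge0 ?exprn_ge0 ?expR_ge0.
have -> : ((2 `^ s * (C * N + C * N))%:E * (q ^+ j)%:E)%E =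
    ((2 `^ s * q ^+ j)%:E * (C * N)%:E +
     (2 `^ s * q ^+ j)%:E * (C * N)%:E)%E :> \bar R.
  by rewrite -!EFinM -EFinD; congr (_%:E); ring.
have c0 : 0 <= 2 `^ s * q ^+ j by rewrite mulr_ge0 ?powR_ge0 ?exprn_ge0 ?expR_ge0.
apply: leeD; apply: (le_trans (le_esumZ _ c0 _));
  try (by move=> g; rewrite lee_fin powR_ge0);
  apply: lee_wpmul2l; rewrite ?lee_fin //; apply: annC => //; exact: expR_gt0.
Qed.

End Poincare.

Section PoincareDivergence.
Context {R : realType}.
Implicit Types (z w v p : H2 R) (g h : PSL2 R).
Context (Gamma : groupClosed (PSL2 R)).

Local Notation Re := complex.Re.
Local Notation Im := complex.Im.
Local Notation i0 := (H2_i R).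

(** The points [m / n + i / (2 r n)] with [m < n] are pairwise so far apart
   that the orbit points near them are distinct, and all lie at distance
   about [log n] from the base point: the [n] corresponding terms already
   contribute a multiple of [n^(1 - s)]. *)
Lemma poincare_pinfty (s : R) : cocompact Gamma -> 0 <= s < 1 ->
  poincare Gamma s = +oo%E.
Proof.
move=> /cocompact_net[r r1 net] /andP[s0 s1].
have r0 : 0 < r by lra.
have low (n : nat) : (0 < n)%N ->
    ((n%:R * (6 * r * r * n%:R)^-1 `^ s)%:E <= poincare Gamma s)%E.
  move=> n0; have n0' : 0 < n%:R :> R by rewrite ltr0n.
  have y0 : 0 < (2 * r * n%:R)^-1 by rewrite invr_gt0 !mulr_gt0.
  (* The height [1 / (2 r n)] makes consecutive points farther apart than two
     points at [cosh_dist] at most [r] from a common orbit point can be. *)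
  pose w (m : nat) : H2 R := mkH2 (m%:R / n%:R) y0.
  have /choice[g gP] : forall m, exists h, h \in Gamma /\
      cosh_dist (w m) (act h i0) <= r.
    by move=> m; have [h hG hr] := net (w m); exists h.
  apply: (ge_esum_enum (e := g)).
  - by move=> m _; have [] := gP m.
  - move=> m m' _ _ E; apply/eqP/negP => /negP mm'.
    have : cosh_dist (w m) (w m') <= 2 * r * r.
      apply: cosh_dist_triangle_le (gP m).2 _.
      by rewrite E cosh_dist_sym (gP m').2.
    have -> : cosh_dist (w m) (w m') =
        1 + 2 * r ^+ 2 * (m%:R - m'%:R) ^+ 2.
      by rewrite /cosh_dist /w /=; field; rewrite ?gt_eqF.
    have : 1 <= (m%:R - m'%:R) ^+ 2 :> R.
      have : 1 <= `|m%:R - m'%:R| :> R.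
        move: mm'; rewrite neq_ltn => /orP[] mm.
          rewrite distrC ger0_norm ?subr_ge0 ?ler_nat 1?ltnW //.
          by rewrite lerBrDl natr1 ler_nat.
        rewrite ger0_norm ?subr_ge0 ?ler_nat 1?ltnW //.
        by rewrite lerBrDl natr1 ler_nat.
      by move=> h; rewrite -(real_normK (num_real _)) exprn_ege1.
    move=> h1 h2; have : 2 * r ^+ 2 * 1 <= 2 * r ^+ 2 * (m%:R - m'%:R) ^+ 2.
      by rewrite ler_pM2l // mulr_gt0 ?exprn_gt0.
    by move: h2; lra.
  - move=> m mn; rewrite lee_fin /orbit_weight.
    apply: ge0_ler_powR; rewrite ?nnegrE ?invr_ge0 ?(ltW (cosh_dist_gt0 _ _)) //.
      by rewrite !mulr_ge0 // ltW.
    rewrite lef_pV2 ?posrE ?cosh_dist_gt0 ?mulr_gt0 //.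
    have -> : 6 * r * r * n%:R = 2 * (3 * r * n%:R) * r by ring.
    apply: cosh_dist_triangle_le (gP m).2.
    rewrite /cosh_dist /w /= sub0r sqrrN.
    have x1 : (m%:R / n%:R) ^+ 2 <= 1 :> R.
      rewrite exprn_ile1 ?divr_ge0 // ler_pdivrMr // mul1r ler_nat; exact: ltnW.
    have y1 : (2 * r * n%:R)^-1 ^+ 2 <= 1 :> R.
      have n1 : 1 <= n%:R :> R by rewrite ler1n.
      have q1 : 1 <= 2 * r * n%:R by nra.
      have q0 : 0 < 2 * r * n%:R by lra.
      by rewrite exprn_ile1 ?invr_ge0 ?(ltW q0) // invf_le1.
    rewrite ler_pdivrMr ?mulr_gt0 //.
    have -> : 3 * r * n%:R * (2 * 1 * (2 * r * n%:R)^-1) = 3.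
      by field; rewrite ?gt_eqF.
    by lra.
  - exact: powR_ge0.
apply/eqP; rewrite eq_le leey /= leNgt; apply/negP => fin.
have P0 : (0 <= poincare Gamma s)%E.
  by apply: esum_ge0 => g _; rewrite lee_fin powR_ge0.
have [x xE] : exists x : R, poincare Gamma s = x%:E.
  by case: (poincare Gamma s) fin P0 => [x||] // _ _; exists x.
rewrite xE in low; pose c : R := (6 * r * r)^-1 `^ s.
have rr0 : 0 < (6 * r * r)^-1 by rewrite invr_gt0 !mulr_gt0.
have c0 : 0 < c by apply: powR_gt0.
(* Chosen so that [(1 - s) ln n] exceeds [x / c], whereas the lower bound reads
   [c n^(1 - s) <= x]. *)
pose n := (Num.truncn (expR ((x / c) / (1 - s)))).+1.
have n0' : 0 < n%:R :> R by rewrite ltr0n.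
have := low n isT; rewrite lee_fin leNgt => /negP; apply.
rewrite invfM powRM ?invr_ge0 ?(ltW rr0) ?(ltW n0') ?ltW //; last first.
  by rewrite !mulr_gt0.
rewrite -/c mulrCA mulrC -ltr_pdivrMr //.
have nE : n%:R = expR (ln n%:R) :> R by rewrite lnK.
rewrite nE -expRN -expRM -expRD.
have ln1 : x / c / (1 - s) < ln n%:R.
  rewrite -[ltLHS]expRK ltr_ln ?posrE ?expR_gt0 //; exact: truncnS_gt.
have s1' : 0 < 1 - s by lra.
have ln2 : x / c < ln n%:R * (1 - s) by rewrite -ltr_pdivrMr.
by have := expR_ge1Dx (ln n%:R + - ln n%:R * s); lra.
Qed.

End PoincareDivergence.

(** * Summation over a conjugacy class *)

Section ConjClassSum.
Context {R : realType}.
Implicit Types (z w v p : H2 R) (g h : PSL2 R).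
Context (Gamma : groupClosed (PSL2 R)).

Local Notation Re := complex.Re.
Local Notation Im := complex.Im.
Local Notation i0 := (H2_i R).

Lemma reduce_mod (x L : R) : 0 < L ->
  exists n : nat, 0 <= x + n%:R * L <= L \/ 0 <= x - n%:R * L <= L.
Proof.
move=> L0; have [x0|x0] := leP 0 x.
  exists (Num.truncn (x / L)); right.
  have /truncn_itv/andP[] : 0 <= x / L by rewrite divr_ge0 // ltW.
  by rewrite ler_pdivlMr // ltr_pdivrMr // -natr1 => h1 h2; lra.
exists (Num.truncn (- x / L)).+1; left.
have /truncn_itv/andP[] : 0 <= - x / L by rewrite divr_ge0 // ?ltW // oppr_gt0.
by rewrite ler_pdivlMr // ltr_pdivrMr // -natr1 => h1 h2; lra.
Qed.

(** Multiplying the conjugating element by a power of [g] slides the orbit point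
   along the axis of [g], here moved to the imaginary axis by [q]. *)
Lemma conj_class_reduced g q (L : R) :
  g \in Gamma -> 0 < L -> g = (dilation L ^ q)%g ->
  forall y, conj_class Gamma g y -> exists h, [/\ h \in Gamma, y = (g ^ h)%g &
    1 <= cmod (act q (act h i0)) <= expR L].
Proof.
move=> gG L0 gE y [k /= kG <-].
set w := act q (act k i0).
have slide (e : PSL2 R) (t : R) : e \in Gamma -> commute g e ->
    (q * e)%g = (dilation t * q)%g ->
    0 <= ln (cmod w) + t <= L ->
    exists h, [/\ h \in Gamma, (g ^ k)%g = (g ^ h)%g &
      1 <= cmod (act q (act h i0)) <= expR L].
  move=> eG ge qe /andP[t0 tL]; exists (e * k)%g; split.
  - by rewrite gpredM.
  - by rewrite conjgM [(g ^ e)%g]conjgE ge mulKg.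
  rewrite actM -[act q (act e _)]actM qe actM cmod_act_dilation -/w.
  rewrite -[cmod w]lnK ?posrE ?cmod_gt0 // -expRD -{1}[1]expR0 !ler_expR.
  by rewrite addrC t0.
have qg n : (q * g ^+ n)%g = (dilation (n%:R * L) * q)%g.
  by rewrite gE -conjXg dilationX conjgE mulVKg.
have [n [h|h]] := reduce_mod (ln (cmod w)) L0.
  apply: (slide (g ^+ n)%g (n%:R * L)) => //; first exact: gpredXn.
  exact/commuteX/commute_refl.
apply: (slide (g ^- n)%g (- (n%:R * L))) => //.
- by rewrite gpredV gpredXn.
- exact/commuteV/commuteX/commute_refl.
have dV : dilation (- (n%:R * L)) = ((dilation (n%:R * L))^-1)%g.
  apply/esym/mulg1_eq; by rewrite -dilationD subrr dilation0.
by rewrite dV; apply: (canRL (mulKg _)); rewrite mulgA -qg mulgK.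
Qed.

(** A reduced conjugating element [h] gives an orbit point [w] in one of the
   [L + 1] half-annuli between [|w| = 1] and [|w| = e^L], and the
   displacement of [i] by [g ^ h] is that of [w] by the dilation of length
   [L]. Hence the weight is at most a multiple of [e^(- s L)] times the power
   [2 s] of the slope of [w], to which [esum_annulus] applies since [2 s >
   1]. *)
Lemma esum_conj_class (s e : R) : discrete_set [set` Gamma] -> 2^-1 < s ->
  0 < e -> exists2 C : R, 0 <= C & forall g, g \in Gamma ->
    e <= translation_length g ->
    (\esum_(y in conj_class Gamma g) (orbit_weight s y)%:E <=
     (C * ((translation_length g + 1) *
           expR (- s * translation_length g)))%:E)%E.
Proof.
move=> dG s2 e0; have s0 : 0 < s by lra.
have [N [N0 sp]] := orbit_sparse (1 + expR 4) dG.
have [|C C0 annC] := @esum_annulus R (2 * s); first by lra.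
pose K : R := (1 - expR (- e)) ^+ 2 / 2.
have K0 : 0 < K.
  have : expR (- e) < 1 by rewrite -expR0 ltr_expR; lra.
  by move=> h; rewrite divr_gt0 // exprn_gt0 // subr_gt0.
exists (K^-1 `^ s * (C * N)); first by rewrite mulr_ge0 ?powR_ge0 // mulr_ge0.
move=> g gG; set L := translation_length g => eL.
have L0 : 0 < L by lra.
have [q gE] := hyperbolic_normal_form L0; rewrite -/L in gE.
have red := conj_class_reduced gG L0 gE.
have /choice[h hP] : forall y, exists h, conj_class Gamma g y ->
    [/\ h \in Gamma, y = (g ^ h)%g & 1 <= cmod (act q (act h i0)) <= expR L].
  move=> y; have [/red[h hP]|ny] := pselect (conj_class Gamma g y).
    by exists h.
  by exists 1%g.
pose w h := act q (act h i0).
pose S := [set` Gamma] `&` [set h | 1 <= cmod (w h) <= expR L].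
apply: (@le_trans _ _ (\esum_(h in S)
    (((K * expR L)^-1 `^ s)%:E * (axis_slope (w h) `^ (2 * s))%:E)%E)).
  apply: (le_esum_inj (e := h)).
  - by move=> y /hP[].
  - move=> y y' /[!inE] /hP[_ yE _] /hP[_ yE' _] hh.
    by rewrite yE yE' hh.
  move=> y /hP[_ yE _]; rewrite -EFinM lee_fin.
  have u0 := axis_slope_ge0 (w (h y)).
  have k0 : 0 < K * expR L by rewrite mulr_gt0 ?expR_gt0.
  have -> : axis_slope (w (h y)) `^ (2 * s) = (axis_slope (w (h y)) ^+ 2) `^ s.
    by rewrite powRrM -powR_mulrn.
  rewrite -powRM ?sqr_ge0 ?invr_ge0 ?(ltW k0) //.
  apply: ge0_ler_powR; rewrite ?nnegrE ?invr_ge0 ?(ltW (cosh_dist_gt0 _ _)) ?(ltW s0) //.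
    by rewrite mulr_ge0 ?invr_ge0 ?(ltW k0) // exprn_ge0.
  have -> : cosh_dist i0 (act y i0) =
      cosh_dist (w (h y)) (act (dilation L) (w (h y))).
    rewrite {1}yE conjgE !actM -(cosh_dist_act (h y)) actKV.
    rewrite -(cosh_dist_act q) -/(w (h y)); congr cosh_dist.
    by rewrite -!actM {1}gE conjgE !mulgA mulgV mul1g.
  rewrite cosh_dist_dilation.
  have -> : cmod (w (h y)) / Im (w (h y)) = (axis_slope (w (h y)))^-1.
    by rewrite /axis_slope invf_div.
  have u0' := axis_slope_gt0 (w (h y)).
  have -> : (K * expR L)^-1 * axis_slope (w (h y)) ^+ 2 =
      (K * expR L / axis_slope (w (h y)) ^+ 2)^-1 by rewrite invf_div mulrC.
  rewrite lef_pV2 ?posrE; last 2 first.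
  - rewrite addr_gt0 // mulr_gt0 ?exprn_gt0 ?invr_gt0 //.
    by rewrite subr_gt0 coshR_gt1.
  - by rewrite mulr_gt0 // invr_gt0 exprn_gt0.
  rewrite exprVn; apply: (@le_trans _ _ ((coshR L - 1) / axis_slope (w (h y)) ^+ 2)).
    by rewrite ler_pM2r ?invr_gt0 ?exprn_gt0 // coshR_sub1_ge.
  by rewrite lerDr.
have c0 : 0 <= (K * expR L)^-1 `^ s by apply: powR_ge0.
apply: (le_trans (le_esumZ _ c0 _)).
  by move=> y; rewrite lee_fin powR_ge0.
have -> : K^-1 `^ s * (C * N) * ((L + 1) * expR (- s * L)) =
    (K * expR L)^-1 `^ s * (C * N * (L + 1)).
  have -> : (K * expR L)^-1 = K^-1 * expR (- L) by rewrite invfM expRN.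
  have k0 : 0 <= K^-1 by rewrite invr_ge0 ltW.
  have -> : expR (- s * L) = expR (- L) `^ s.
    by rewrite -expRM; congr expR; ring.
  by rewrite (powRM _ k0 (expR_ge0 _)); ring.
rewrite EFinM; apply: lee_wpmul2l; first by rewrite lee_fin.
pose k h := Num.truncn (ln (cmod (w h))).
pose M := (Num.truncn L).+1.
have lnP y : S y -> 0 <= ln (cmod (w y)) <= L.
  move=> [_ /= /andP[h1 h2]]; rewrite ln_ge0 //=.
  by rewrite -[leRHS]expRK ler_ln ?posrE ?cmod_gt0 ?expR_gt0.
rewrite (esum_fiber (B := `I_M) (k := k)); last first.
- by move=> y; rewrite lee_fin powR_ge0.
- move=> y /lnP/andP[l0 lL]; rewrite /= /M ltnS truncn_le_nat.
  by apply: le_lt_trans lL (truncnS_gt L).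
have ML : M%:R <= L + 1.
  rewrite /M -natr1 lerD2r.
  by have /truncn_itv/andP[] := ltW L0.
apply: (@le_trans _ _ (C * N * M%:R)%:E); last first.
  by rewrite lee_fin ler_wpM2l // mulr_ge0.
apply: esum_bounded; first by rewrite mulr_ge0.
  move=> j _; apply: le_trans (annC _ _ _ _ (expR j%:R) (sp q) (expR_gt0 _)).
  apply: esum_subset => y [Sy /= yj]; split; first by case: Sy.
  have /andP[l0 _] := lnP y Sy.
  have := truncn_itv l0; rewrite -/(k y) yj => /andP[h1 h2] /=.
  rewrite -expRD -/(w y) -[cmod (w y)]lnK ?posrE ?cmod_gt0 // !ler_expR h1 /=.
  by move: h2; rewrite -natr1; lra.
by rewrite esum_ordinal.
Qed.

End ConjClassSum.

(** * The length spectrum *)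

Section LengthSpectrum.
Context {R : realType}.
Implicit Types (z w v p : H2 R) (g h : PSL2 R) (c : set (PSL2 R)).
Context (Gamma : groupClosed (PSL2 R)).

Local Notation i0 := (H2_i R).
Local Notation prim := (prim_classes Gamma).
Local Notation len c := (translation_length (class_rep c)).

Lemma class_rep_conj g : g \in Gamma -> exists2 h, h \in Gamma &
  class_rep (conj_class Gamma g) = (g ^ h)%g.
Proof.
move=> gG; have : conj_class Gamma g (class_rep (conj_class Gamma g)).
  by apply: (@xgetI _ 1%g (conj_class Gamma g) g); exists 1%g;
    rewrite ?conjg1 //=; exact: gpred1.
by move=> [h hG <-]; exists h.
Qed.

Lemma class_rep_in c : prim c -> class_rep c \in Gamma.
Proof.
move=> [g [gG _ _] <-]; have [h hG ->] := class_rep_conj gG.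
by rewrite gpredJ.
Qed.

Lemma conj_class_eq g y : conj_class Gamma g y ->
  conj_class Gamma y = conj_class Gamma g.
Proof.
move=> [h /= hG <-]; apply/seteqP; split => x [k /= kG <-].
  by exists (h * k)%g; rewrite ?conjgM //= gpredM.
by exists (h^-1 * k)%g; rewrite -?conjgM ?mulVKg //= gpredM // gpredV.
Qed.

Lemma conj_class_rep c : prim c -> conj_class Gamma (class_rep c) = c.
Proof.
move=> [g [gG _ _] <-]; have [h hG E] := class_rep_conj gG.
by apply: conj_class_eq; rewrite E; exists h.
Qed.

Definition length_sum (s : R) : \bar R :=
  \esum_(p in prim `*` [set k : nat | (0 < k)%N])
    (expR (- s * p.2%:R * len p.1))%:E.

(** The powers of a very short class would contribute many terms close to [1]. *)
Lemma length_sum_systole (s : R) : (length_sum s < +oo)%E ->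
  exists2 e : R, 0 < e & forall c, prim c -> e <= len c.
Proof.
move=> fin.
have P0 : (0 <= length_sum s)%E by apply: esum_ge0 => p _; rewrite lee_fin expR_ge0.
have [x xE] : exists x : R, length_sum s = x%:E.
  by case: (length_sum s) fin P0 => [x||] // _ _; exists x.
(* If the length were below the claimed bound, each of the first [n] powers
   would contribute at least [1 / e], and [n / e] exceeds the sum [x]. *)
pose n := (Num.truncn (`|x| * expR 1)).+1.
have n0 : 0 < n%:R :> R by rewrite ltr0n.
have nx : x * expR 1 < n%:R.
  by apply: le_lt_trans (truncnS_gt _); rewrite ler_pM2r ?expR_gt0 // ler_norm.
have q0 : 0 < `|s| * n%:R + 1 by rewrite ltr_wpDl // mulr_ge0.
exists (`|s| * n%:R + 1)^-1; first by rewrite invr_gt0.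
move=> c cP; have l0 := translation_length_ge0 (class_rep c).
rewrite leNgt; apply/negP => le.
have nl : `|s| * n%:R * len c <= 1.
  have : (`|s| * n%:R + 1) * len c < 1 by rewrite mulrC -ltr_pdivlMr // mul1r.
  by lra.
have : ((n%:R * expR (- 1))%:E <= length_sum s)%E.
  apply: (ge_esum_enum (e := fun k => (c, k.+1))).
  - by [].
  - by move=> k k' _ _ [].
  - move=> k kn; rewrite lee_fin ler_expR lerNl /=.
    apply: le_trans nl; rewrite !mulNr opprK ler_wpM2r //.
    apply: (@le_trans _ _ (`|s| * k.+1%:R)); first by rewrite ler_wpM2r ?ler_norm.
    by rewrite ler_wpM2l // ler_nat.
  - exact: expR_ge0.
rewrite xE lee_fin expRN ler_pdivrMr ?expR_gt0 // => h.
by move: nx; rewrite ltNge h.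
Qed.

(** Every class contains an element whose axis passes near the base point, and
   which therefore moves it by little more than the translation length. *)
Lemma conj_near_axis r g :
  (forall z, exists2 h, h \in Gamma & cosh_dist z (act h i0) <= r) ->
  0 < translation_length g ->
  exists2 y, conj_class Gamma g y &
    cosh_dist i0 (act y i0) <= 2 * (2 * r * expR (translation_length g)) * r.
Proof.
move=> net L0; have [q gE] := hyperbolic_normal_form L0.
set L := translation_length g in L0 gE *.
pose p := act q^-1%g i0.
have pg : cosh_dist p (act g p) <= expR L.
  have -> : cosh_dist p (act g p) = coshR L.
    rewrite -(cosh_dist_act q) /p actKV gE conjgE !actM !actKV.
    rewrite cosh_dist_dilation H2_i_cmod /= divr1 expr1n mulr1; ring.
  rewrite /coshR; have : expR (- L) <= expR L by rewrite ler_expR; lra.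
  by lra.
have [h hG hp] := net p.
exists (g ^ h)%g; first by exists h.
rewrite conjgE !actM -(cosh_dist_act h) actKV.
apply: (@cosh_dist_triangle_le _ _ (act g p)).
  by apply: cosh_dist_triangle_le pg; rewrite cosh_dist_sym.
by rewrite cosh_dist_act.
Qed.

(** The powers of a class form a geometric series of ratio at most [exp (- s
   e)], and the classes themselves inject into [Gamma] through their members
   of [conj_near_axis]. *)
Lemma length_sum_lt_pinfty (s e : R) :
  discrete_set [set` Gamma] -> cocompact Gamma ->
  0 < e -> (forall c, prim c -> e <= len c) -> 1 < s -> (length_sum s < +oo)%E.
Proof.
move=> dG /cocompact_net[r r1 net] e0 sys s1.
have r0 : 0 < r by lra.
have fin := poincare_lt_pinfty dG s1.
have [P PE] : exists x : R, poincare Gamma s = x%:E.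
  have : (0 <= poincare Gamma s)%E.
    by apply: esum_ge0 => p _; rewrite lee_fin powR_ge0.
  by case: (poincare Gamma s) fin => [x||] // _ _; exists x.
have near : forall c, exists y, prim c -> c y /\
    cosh_dist i0 (act y i0) <= 2 * (2 * r * expR (len c)) * r.
  move=> c; have [cP|nc] := pselect (prim c); last by exists 1%g.
  have [|y yc yr] := @conj_near_axis r (class_rep c) net.
    exact: lt_le_trans (sys c cP).
  by exists y => _; split=> //; rewrite -(conj_class_rep cP).
move/choice : near => [y yP].
pose q := expR (- (s * e)).
have q01 : 0 <= q < 1.
  by rewrite expR_ge0 /= -[1 in ltRHS]expR0 ltr_expR oppr_lt0 mulr_gt0 //; lra.
have q1 : 0 <= (1 - q)^-1 by rewrite invr_ge0 subr_ge0 ltW //; case/andP: q01.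
have sum1 : (\esum_(c in prim) (expR (- s * len c))%:E <=
             ((4 * r * r) `^ s * P)%:E)%E.
  apply: (@le_trans _ _ (\esum_(g in [set` Gamma])
      (((4 * r * r) `^ s)%:E * (orbit_weight s g)%:E)%E)).
    apply: (le_esum_inj (e := y)).
    - move=> c cP; have [cy _] := yP c cP.
      move: cy; rewrite -{1}(conj_class_rep cP) => -[h hG <-].
      by rewrite /= gpredJ // class_rep_in.
    - move=> c c' /[!inE] cP cP' yy.
      have cE c1 : prim c1 -> conj_class Gamma (y c1) = c1.
        move=> c1P; rewrite -[RHS](conj_class_rep c1P); apply: conj_class_eq.
        by rewrite conj_class_rep //; have [] := yP c1 c1P.
      by rewrite -(cE c) // yy cE.
    move=> c cP; have [_ yr] := yP c cP.
    rewrite -EFinM lee_fin /orbit_weight.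
    have X0 := cosh_dist_gt0 i0 (act (y c) i0).
    rewrite -powRM ?invr_ge0 ?(ltW X0) ?mulr_ge0 ?(ltW r0) //.
    have -> : expR (- s * len c) = expR (- len c) `^ s.
      by rewrite -expRM; congr expR; ring.
    apply: ge0_ler_powR; rewrite ?nnegrE ?expR_ge0 //; first lra.
      by rewrite mulr_ge0 ?invr_ge0 ?(ltW X0) ?mulr_ge0 ?(ltW r0).
    rewrite ler_pdivlMr // expRN ler_pdivrMl ?expR_gt0 //.
    by apply: le_trans yr _; lra.
  apply: (le_trans (le_esumZ _ (powR_ge0 _ _) _)).
    by move=> g; rewrite lee_fin powR_ge0.
  by rewrite -/(poincare Gamma s) PE EFinM.
rewrite /length_sum (esum_fiber (B := prim) (k := fst)); last first.
- by move=> p; rewrite lee_fin expR_ge0.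
- by move=> p [].
apply: (@esum_lt_pinfty _ _ _ ((1 - q)^-1 * ((4 * r * r) `^ s * P))).
apply: (@le_trans _ _ (\esum_(c in prim)
    ((1 - q)^-1%:E * (expR (- s * len c))%:E)%E)); last first.
  apply: (le_trans (le_esumZ _ q1 _)).
    by move=> c; rewrite lee_fin expR_ge0.
  by rewrite EFinM; apply: lee_wpmul2l => //; rewrite lee_fin.
apply: le_esum => c cP.
apply: (@le_trans _ _ (\esum_(j in [set: nat])
    ((expR (- s * len c))%:E * (q ^+ j)%:E)%E)).
  apply: (le_esum_inj (e := fun p : set (PSL2 R) * nat => p.2.-1)) => //.
    move=> [c1 k1] [c2 k2] /set_mem[[_ /= k10] E1] /set_mem[[_ /= k20] E2] /= kk.
    by move: E1 E2 => /= -> ->; rewrite -(prednK k10) -(prednK k20) kk.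
  move=> [c1 k1] [[_ /= k10] /= ->]; rewrite -EFinM lee_fin -expRM_natl -expRD.
  rewrite ler_expR -{1}(prednK k10) -natr1.
  have := sys c cP; set l := len c => el.
  have : k1.-1%:R * (s * e) <= k1.-1%:R * (s * l) :> R.
    by rewrite ler_wpM2l // ler_pM2l //; lra.
  by lra.
apply: (le_trans (le_esumZ _ (expR_ge0 _) _)).
  by move=> j; rewrite lee_fin exprn_ge0 //; case/andP: q01.
rewrite [leRHS]muleC; apply: lee_wpmul2l; first by rewrite lee_fin expR_ge0.
exact: esum_geometric.
Qed.

(** Convergence at some [s < 1] would carry over to the orbital series at an
   exponent [t] with [max s (1/2) < t < 1]: the factor [L + 1] in
   [esum_conj_class] is absorbed by [exp ((t - s) L)]. *)
Lemma length_sum_pinfty (s e : R) :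
  discrete_set [set` Gamma] -> cocompact Gamma -> torsion_free Gamma ->
  0 < e -> (forall c, prim c -> e <= len c) -> s < 1 ->
  length_sum s = +oo%E.
Proof.
move=> dG cG tG e0 sys s1.
pose t : R := (1 + Num.max s 2^-1) / 2.
have [sm hm m1] : [/\ s <= Num.max s 2^-1, 2^-1 <= Num.max s 2^-1 & Num.max s 2^-1 < 1].
  by rewrite !le_max !lexx orbT gt_max s1; split=> //=; lra.
have [t1 th ts] : [/\ t < 1, 2^-1 < t & 0 < t - s].
  by split; rewrite /t; lra.
have [C C0 classC] := esum_conj_class dG th e0.
have div := @poincare_pinfty R Gamma t cG.
apply/eqP; rewrite eq_le leey /= leNgt; apply/negP => fin.
have [x xE] : exists x : R, length_sum s = x%:E.
  have : (0 <= length_sum s)%E by apply: esum_ge0 => p _; rewrite lee_fin expR_ge0.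
  by case: (length_sum s) fin => [x||] // _ _; exists x.
have : (poincare Gamma t < +oo)%E; last first.
  by rewrite div ?ltxx //; apply/andP; split=> //; lra.
pose rest := [set g | g \in Gamma /\ g <> 1%g].
have ow0 g : (0 <= (orbit_weight t g)%:E)%E by rewrite lee_fin powR_ge0.
apply: (@esum_lt_pinfty _ _ _ (orbit_weight t 1%g + C * (1 + (t - s)^-1) * x)).
apply: (@le_trans _ _ (\esum_(g in [set 1%g] `|` rest) (orbit_weight t g)%:E)).
  apply: esum_subset => g gG; have [->|g1] := eqVneq g 1%g; first by left.
  by right; split=> //; apply/eqP.
apply: (le_trans (esum_setU_le _ _ ow0)).
rewrite esum_set1 // EFinD; apply: leeD => //.
have /choice[k kP] : forall g, exists p : set (PSL2 R) * nat, rest g ->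
    [/\ prim p.1, (0 < p.2)%N & conj_class Gamma (class_rep p.1 ^+ p.2)%g g].
  move=> g; have [[gG /eqP g1]|ng] := pselect (rest g); last by exists (set0, 0%N).
  have [h [n [hP n0 gE]]] := primitive_root dG tG gG g1.
  exists (conj_class Gamma h, n) => _; split=> //=; first by exists h.
  have [f fG ->] := class_rep_conj (let: And3 hG _ _ := hP in hG).
  by exists f^-1%g; rewrite /= ?gpredV // -conjXg conjgK.
rewrite (esum_fiber (B := prim `*` [set n | (0 < n)%N]) (k := k)) //; last first.
  by move=> g /kP[].
have ts0 : 0 <= (t - s)^-1 by rewrite invr_ge0 ltW.
have c0 : 0 <= C * (1 + (t - s)^-1) by rewrite mulr_ge0 // addr_ge0.
apply: (@le_trans _ _ (\esum_(p in prim `*` [set n | (0 < n)%N])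
    ((C * (1 + (t - s)^-1))%:E * (expR (- s * p.2%:R * len p.1))%:E)%E)); last first.
  apply: (le_trans (le_esumZ _ c0 _)).
    by move=> p; rewrite lee_fin expR_ge0.
  by rewrite -/(length_sum s) xE EFinM.
apply: le_esum => -[c n] [/= cP n0].
have l0 : 0 <= len c by exact: translation_length_ge0.
have LE := translation_lengthX (class_rep c) n.
apply: (@le_trans _ _ (\esum_(y in conj_class Gamma (class_rep c ^+ n)%g)
    (orbit_weight t y)%:E)).
  by apply: esum_subset => g [rg /= gk]; have [_ _] := kP g rg; rewrite gk.
apply: le_trans (classC _ _ _) _.
- by rewrite gpredXn // class_rep_in.
- rewrite LE; apply: le_trans (sys c cP) _.
  by rewrite ler_peMl // ler1n.
rewrite LE -EFinM lee_fin -[leRHS]mulrA; apply: ler_wpM2l => //.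
set L := n%:R * len c.
have L0 : 0 <= L by rewrite mulr_ge0.
have -> : - s * n%:R * len c = (t - s) * L + - t * L by rewrite /L; ring.
rewrite expRD [leRHS]mulrA; apply: ler_wpM2r; first exact: expR_ge0.
have h1 := expR_ge1Dx ((t - s) * L).
apply: le_trans (_ : (1 + (t - s)^-1) * (1 + (t - s) * L) <= _); last first.
  by rewrite ler_wpM2l // addr_ge0.
have -> : (1 + (t - s)^-1) * (1 + (t - s) * L) =
    L + 1 + (t - s)^-1 + (t - s) * L by field; rewrite gt_eqF.
rewrite -addrA lerDl addr_ge0 // mulr_ge0 //; exact: ltW.
Qed.

End LengthSpectrum.

(** * The Manhattan curve *)

Section ManhattanCurve.
Context {R : realType}.
Context (Gamma : groupClosed (PSL2 R)) (rho : PSL2 R -> PSL2 R).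
Implicit Types (a b s : R) (c : set (PSL2 R)).

Local Notation prim := (prim_classes Gamma).
Local Notation len c := (translation_length (class_rep c)).
Local Notation rlen c := (translation_length (rho (class_rep c))).
Local Notation msum := (manhattan_sum Gamma rho).

Lemma le_manhattan_sum a b a' b' :
  (forall c, prim c -> a * rlen c + b * len c <= a' * rlen c + b' * len c) ->
  (msum a' b' <= msum a b)%E.
Proof.
move=> H; apply: le_esum => -[c k] [/= cP k0]; rewrite lee_fin ler_expR.
have := H c cP; set x := _ + _; set y := _ + _ => xy.
have : k%:R * x <= k%:R * y by rewrite ler_wpM2l.
by rewrite /x /y; lra.
Qed.

Lemma manhattan_sum_gt0 a b c : (msum a b < +oo)%E -> prim c ->
  0 < a * rlen c + b * len c.
Proof.
move=> fin cP; rewrite ltNge; apply/negP => le0.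
have [x xE] : exists x : R, msum a b = x%:E.
  have : (0 <= msum a b)%E by apply: esum_ge0 => p _; rewrite lee_fin expR_ge0.
  by case: (msum a b) fin => [x||] // _ _; exists x.
pose n := (Num.truncn x).+1.
have : ((n%:R * 1)%:E <= msum a b)%E.
  apply: (ge_esum_enum (e := fun k => (c, k.+1))) => //.
  - by move=> k k' _ _ [].
  - move=> k kn; rewrite lee_fin -[leLHS]expR0 ler_expR /=.
    have : 0 <= k.+1%:R * - (a * rlen c + b * len c).
      by rewrite mulr_ge0 // oppr_ge0.
    by lra.
by rewrite xE lee_fin mulr1 leNgt truncnS_gt.
Qed.

Lemma manhattan_curve_near a b (e : R) :
  manhattan_curve Gamma rho (a, b) -> 0 < e ->
  exists a' b', [/\ `|a - a'| < e, `|b - b'| < e & (msum a' b' < +oo)%E].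
Proof.
move=> [clo _] e0; have [|[a' b'] [D [/= h1 h2]]] := clo (ball (a, b) e).
  exact: nbhsx_ballx.
by exists a', b'.
Qed.

(** Without classes the domain of convergence would be the whole plane, which
   has empty boundary. *)
Lemma manhattan_curve_nonempty a b : manhattan_curve Gamma rho (a, b) ->
  prim !=set0.
Proof.
move=> [_ nint]; apply/set0P/eqP => P0; apply: nint.
suff -> : manhattan_domain Gamma rho = setT by rewrite interiorT.
apply/seteqP; split=> // -[a' b'] _ /=.
by rewrite /manhattan_domain /= /manhattan_sum P0 set0X esum_set0 ltry.
Qed.

(** A curve which reaches the half-plane [a < 0] bounds the ratios of the
   lengths: for a class the series over its powers converges only if [a *
   rlen c + b * len c > 0]. *)
Lemma manhattan_curve_comparable a b : a < 0 -> manhattan_curve Gamma rho (a, b) ->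
  exists K : R, forall c, prim c -> 0 < len c /\ rlen c <= K * len c.
Proof.
move=> a0 /manhattan_curve_near/(_ (_ : 0 < - a))[].
  by rewrite oppr_gt0.
move=> a' [b' [ha _ fin]].
have a'0 : a' < 0 by move: ha; rewrite ltr_norml; lra.
exists (b' / - a') => c cP; have := manhattan_sum_gt0 fin cP => pos.
have r0 := translation_length_ge0 (rho (class_rep c)).
have l0 := translation_length_ge0 (class_rep c).
have ar : 0 <= - a' * rlen c by rewrite mulr_ge0 // oppr_ge0 ltW.
split.
  rewrite lt_neqAle l0 andbT; apply/eqP => e; rewrite -e mulr0 in pos; lra.
by rewrite mulrAC ler_pdivlMr ?oppr_gt0 //; lra.
Qed.

(** A point of the domain close to the curve can be moved onto the vertical
   line through [a]: changing the first coordinate by [e] is compensated by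
   raising the second by [K e]. *)
Lemma manhattan_curve_above a b b' (K : R) : 0 <= K ->
  (forall c, prim c -> rlen c <= K * len c) ->
  manhattan_curve Gamma rho (a, b) -> b < b' -> (msum a b' < +oo)%E.
Proof.
move=> K0 rK curve bb'.
have e0 : 0 < (b' - b) / (K + 1) by rewrite divr_gt0 ?subr_gt0 ?ltr_wpDl.
have [a1 [b1 [ha hb fin]]] := manhattan_curve_near curve e0.
apply: le_lt_trans fin; apply: le_manhattan_sum => c cP.
have eK : (b' - b) / (K + 1) * K + (b' - b) / (K + 1) = b' - b.
  by field; rewrite gt_eqF // ltr_wpDl.
set e := (b' - b) / (K + 1) in e0 ha hb eK.
have l0 := translation_length_ge0 (class_rep c).
have r0 := translation_length_ge0 (rho (class_rep c)).
move: ha hb; rewrite !ltr_norml => /andP[ha1 ha2] /andP[hb1 hb2].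
have h1 : (a1 - a) * rlen c <= e * rlen c by rewrite ler_wpM2r //; lra.
have h2 : e * rlen c <= e * (K * len c) by rewrite ler_wpM2l ?rK // ltW.
have h3 : e * K * len c <= (b' - b1) * len c by rewrite ler_wpM2r //; lra.
by lra.
Qed.

(** By the same compensation, a point of the domain strictly below the curve
   would make the point of the curve interior. *)
Lemma manhattan_curve_below a b b' (K : R) : 0 <= K ->
  (forall c, prim c -> rlen c <= K * len c) ->
  manhattan_curve Gamma rho (a, b) -> (msum a b' < +oo)%E -> b <= b'.
Proof.
move=> K0 rK [_ nint] fin; rewrite leNgt; apply/negP => b'b; apply: nint.
have e0 : 0 < (b - b') / (K + 1) by rewrite divr_gt0 ?subr_gt0 ?ltr_wpDl.
have eK : (b - b') / (K + 1) * K + (b - b') / (K + 1) = b - b'.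
  by field; rewrite gt_eqF // ltr_wpDl.
set e := (b - b') / (K + 1) in e0 eK.
apply/nbhs_ballP; exists e => // -[a1 b1] [/= ha hb].
apply: le_lt_trans fin; apply: le_manhattan_sum => c cP /=.
have l0 := translation_length_ge0 (class_rep c).
have r0 := translation_length_ge0 (rho (class_rep c)).
move: ha hb; rewrite /ball /= !ltr_norml => /andP[ha1 ha2] /andP[hb1 hb2].
have h1 : (a - a1) * rlen c <= e * rlen c by rewrite ler_wpM2r //; lra.
have h2 : e * rlen c <= e * (K * len c) by rewrite ler_wpM2l ?rK // ltW.
have h3 : e * K * len c <= (b1 - b') * len c by rewrite ler_wpM2r //; lra.
by lra.
Qed.

Lemma length_ratio_bounds (K : R) : prim !=set0 ->
  (forall c, prim c -> 0 < len c /\ rlen c <= K * len c) ->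
  exists m M : R, [/\ I_minus Gamma rho = m%:E, I_plus Gamma rho = M%:E, 0 <= M &
    forall c, prim c -> m * len c <= rlen c <= M * len c].
Proof.
move=> [c0 c0P] HK.
have ratio0 c : 0 <= length_ratio rho c by rewrite divr_ge0 ?translation_length_ge0.
have ratioK c : prim c -> length_ratio rho c <= K.
  by move=> /HK[l0 rK]; rewrite ler_pdivrMr.
have [m mE] : exists m : R, I_minus Gamma rho = m%:E.
  have : (0 <= I_minus Gamma rho)%E.
    by apply: le_ereal_inf_tmp => _ [c _ <-]; rewrite lee_fin.
  have : (I_minus Gamma rho <= (length_ratio rho c0)%:E)%E.
    by apply: ereal_inf_lbound; exists c0.
  by case: (I_minus Gamma rho) => [x||] //; exists x.
have [M ME] : exists M : R, I_plus Gamma rho = M%:E.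
  have : ((length_ratio rho c0)%:E <= I_plus Gamma rho)%E.
    by apply: ereal_sup_ubound; exists c0.
  have : (I_plus Gamma rho <= K%:E)%E.
    by apply: ge_ereal_sup => _ [c cP <-]; rewrite lee_fin ratioK.
  by case: (I_plus Gamma rho) => [x||] //; exists x.
have le_M c : prim c -> length_ratio rho c <= M.
  by move=> cP; rewrite -lee_fin -ME; apply: ereal_sup_ubound; exists c.
exists m, M; split=> //; first exact: le_trans (ratio0 c0) (le_M c0 c0P).
move=> c cP; have [l0 _] := HK c cP; apply/andP; split; last first.
  by rewrite -ler_pdivrMr //; exact: le_M.
rewrite -ler_pdivlMr // -lee_fin -mE; apply: ereal_inf_lbound; by exists c.
Qed.

End ManhattanCurve.

(** * Representations of Teichmueller type *)

Section TeichmullerType.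
Context {R : realType}.
Context (Gamma : groupClosed (PSL2 R)) (V : vectType R[i]).
Context (varrho : PSL2 R -> 'End(V)) (rho : PSL2 R -> PSL2 R) (beta : R).

Lemma teichmuller_repX g n : teichmuller_rep Gamma rho -> g \in Gamma ->
  (0 < n)%N -> rho (g ^+ n)%g = (rho g ^+ n)%g.
Proof.
move=> [rhoM _ _] gG; case: n => // n _; elim: n => [|n IH].
  by rewrite !expg1.
by rewrite expgS rhoM ?gpredXn // IH -expgS.
Qed.

(** The trace of the power [k] of a class is comparable to [exp (beta k r)],
   with [r] the translation length of the class in the image of [rho]. *)
Lemma crit_sum_finite (s : R) : teichmuller_rep Gamma rho ->
  teichmuller_type Gamma varrho rho beta ->
  (crit_sum Gamma varrho s < +oo)%E <->
  (manhattan_sum Gamma rho (- beta) s < +oo)%E.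
Proof.
move=> teich [N [C [_ C0 type]]].
have trE c k : prim_classes Gamma c -> (0 < k)%N ->
    C^-1 * expR (beta * (k%:R * translation_length (rho (class_rep c)))) <=
      Normc.normc (lftrace (varrho (class_rep c ^+ k)%g)) <=
    C * expR (beta * (k%:R * translation_length (rho (class_rep c)))).
  move=> cP k0; have cG := class_rep_in cP.
  have [] := type (class_rep c ^+ k)%g (gpredXn _ cG).
  by rewrite (teichmuller_repX teich) // translation_lengthX.
have fac c (k : nat) : expR (- - beta * k%:R * translation_length (rho (class_rep c))
    - s * k%:R * translation_length (class_rep c)) =
  expR (beta * (k%:R * translation_length (rho (class_rep c)))) *
  expR (- s * k%:R * translation_length (class_rep c)).
  by rewrite -expRD; congr expR; ring.
have norm0 (z : R[i]) : 0 <= Normc.normc z by case: z => x y; exact: sqrtr_ge0.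
split=> fin.
- apply: (@le_lt_trans _ _ (C%:E * crit_sum Gamma varrho s)%E).
    apply: le_trans (le_esumZ _ (ltW C0) _); last first.
      by move=> p; rewrite lee_fin mulr_ge0 ?expR_ge0.
    apply: le_esum => -[c k] [/= cP k0]; rewrite -EFinM lee_fin fac [leRHS]mulrA.
    rewrite ler_wpM2r ?expR_ge0 //.
    by have /andP[h _] := trE c k cP k0; rewrite -(ler_pdivrMl _ _ C0).
  apply: lte_mul_pinfty; rewrite ?lee_fin ?(ltW C0) //.
- apply: (@le_lt_trans _ _ (C%:E * manhattan_sum Gamma rho (- beta) s)%E).
    apply: le_trans (le_esumZ _ (ltW C0) _); last first.
      by move=> p; rewrite lee_fin expR_ge0.
    apply: le_esum => -[c k] [/= cP k0]; rewrite -EFinM lee_fin fac [leRHS]mulrA.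
    rewrite ler_wpM2r ?expR_ge0 //.
    by have /andP[_ h] := trE c k cP k0.
  by apply: lte_mul_pinfty; rewrite ?lee_fin ?(ltW C0).
Qed.

End TeichmullerType.

Theorem proposition6p4 (R : realType) (Gamma : groupClosed (PSL2 R))
    (V : vectType R[i]) (varrho : PSL2 R -> 'End(V))
    (rho : PSL2 R -> PSL2 R) (beta eta : R)
    (Gamma_discrete : discrete_set [set` Gamma])
    (Gamma_cocompact : cocompact Gamma)
    (Gamma_torsion_free : torsion_free Gamma)
    (varrho_rep : linear_rep Gamma varrho)
    (rho_teichmuller : teichmuller_rep Gamma rho)
    (beta_gt0 : 0 < beta)
    (varrho_type : teichmuller_type Gamma varrho rho beta)
    (eta_curve : manhattan_curve Gamma rho (- (2 * beta), eta)) :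
  let delta := critical_exponent Gamma varrho in
  let delta0 := eta / 2 in
  ((2^-1)%:E * delta + (beta / 2)%:E * I_minus Gamma rho <= delta0%:E /\
   delta0%:E <= (2^-1)%:E * delta + (beta / 2)%:E * I_plus Gamma rho)%E /\
  (I_minus Gamma rho = 1%E -> I_plus Gamma rho = 1%E ->
   delta0%:E = ((2^-1)%:E * (delta + beta%:E))%E /\ delta0 = 2^-1 + beta).
Proof.
move=> delta delta0.
have a0 : - (2 * beta) < 0 by lra.
have prim0 := manhattan_curve_nonempty eta_curve.
have [K HK] := manhattan_curve_comparable a0 eta_curve.
have [m [M [mE ME M0 HmM]]] := length_ratio_bounds prim0 HK.
have rM c : prim_classes Gamma c -> translation_length (rho (class_rep c)) <=
    M * translation_length (class_rep c) by move=> /HmM/andP[].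
have above b := manhattan_curve_above M0 rM eta_curve (b' := b).
have below b := manhattan_curve_below M0 rM eta_curve (b' := b).
have critP s := crit_sum_finite s rho_teichmuller varrho_type.
have crit_gt0 s : (crit_sum Gamma varrho s < +oo)%E -> 0 < s.
  move=> /critP fin; have [c cP] := prim0.
  have := manhattan_sum_gt0 fin cP; have [l0 _] := HK c cP.
  have := translation_length_ge0 (rho (class_rep c)) => r0 h.
  have br : 0 <= beta * translation_length (rho (class_rep c)).
    by rewrite mulr_ge0 // ltW.
  by rewrite -(pmulr_lgt0 _ l0); lra.
have crit_low b : eta < b -> (crit_sum Gamma varrho (b - beta * m) < +oo)%E.
  move=> /above fin; apply/critP; apply: le_lt_trans fin.
  apply: le_manhattan_sum => c cP; have /andP[h _] := HmM c cP.
  have := ler_wpM2l (ltW beta_gt0) h; lra.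
have crit_up s : (crit_sum Gamma varrho s < +oo)%E -> eta <= s + beta * M.
  move=> /critP fin; apply: below; apply: le_lt_trans fin.
  apply: le_manhattan_sum => c cP; have /andP[_ h] := HmM c cP.
  have := ler_wpM2l (ltW beta_gt0) h; lra.
have [d dE] : exists d : R, delta = d%:E.
  have e1 : eta < eta + 1 by rewrite ltrDl.
  have fin := crit_low _ e1.
  have : (delta <= (eta + 1 - beta * m)%:E)%E.
    apply: ereal_inf_lbound; exists (eta + 1 - beta * m) => //.
    by split=> //; exact: crit_gt0.
  have : (0 <= delta)%E.
    by apply: le_ereal_inf_tmp => _ [s [s0 _] <-]; rewrite lee_fin ltW.
  by case: delta => [x||] //; exists x.
have low : d <= eta - beta * m.
  apply/ler_addgt0Pr => e e0; rewrite addrAC -lee_fin -dE.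
  have fin : (crit_sum Gamma varrho (eta + e - beta * m) < +oo)%E.
    by apply: crit_low; lra.
  by apply: ereal_inf_lbound; exists (eta + e - beta * m) => //; split=> //;
    apply: crit_gt0.
have up : eta - beta * M <= d.
  rewrite -lee_fin -dE; apply: le_ereal_inf_tmp => _ [s [_ fin] <-].
  by rewrite lee_fin; have := crit_up s fin; lra.
rewrite dE mE ME /delta0; split.
  by rewrite -!EFinM -!EFinD !lee_fin; split; lra.
move=> [m1] [M1]; rewrite -EFinD -EFinM.
rewrite m1 M1 in low up *; split; first by congr (_%:E); lra.
suff : eta - 2 * beta = 1 by lra.
have rE c : prim_classes Gamma c ->
    translation_length (rho (class_rep c)) = translation_length (class_rep c).
  by move=> /HmM; rewrite m1 M1 !mul1r => h; apply/esym/le_anti.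
have msumE a b : manhattan_sum Gamma rho a b = length_sum Gamma (a + b).
  apply: eq_esum => -[c k] [/= cP _]; rewrite rE //.
  by congr (expR _)%:E; ring.
have fin b : eta < b -> (length_sum Gamma (b - 2 * beta) < +oo)%E.
  by move=> /above; rewrite msumE addrC.
have [e e0 sys] : exists2 e : R, 0 < e &
    forall c, prim_classes Gamma c -> e <= translation_length (class_rep c).
  by apply: (@length_sum_systole _ _ (eta + 1 - 2 * beta)); apply: fin; lra.
apply/le_anti/andP; split.
- rewrite lerBlDr; apply/ler_addgt0Pr => x x0; apply: below; rewrite msumE.
  by apply: (length_sum_lt_pinfty _ _ e0 sys) => //; lra.
- rewrite leNgt; apply/negP => lt1.
  pose b := (eta + (1 + 2 * beta)) / 2.
  have := fin b; rewrite (length_sum_pinfty _ _ _ e0 sys) // /b; last by lra.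
  by rewrite ltxx => H; suff : false by []; apply: H; lra.
Qed.
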